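(* Let $X$ be a Banach function space over $\mathbf{R}^d$ with the Fatou property. Consider: (a) $X\in\mathcal{G}$; (b) there are $C_2,\widetilde C_2>0$ such that for all pairwise disjoint collections of cubes $\mathcal{P}$ and all $f\in X$ supported in $\bigcup_{Q\in\mathcal{P}}Q$, \[\widetilde C_2^{-1}\|f\|_X\le\Big\|\sum_{Q\in\mathcal{P}}\|f\|_{X_Q}\mathbf{1}_Q\Big\|_X\le C_2\|f\|_X;\] (c) there is $C_3>0$ such that for all pairwise disjoint collections of cubes $\mathcal{P}$ and all $f\in X$, \[\Big\|\sum_{Q\in\mathcal{P}}\|f\|_{X_Q}\mathbf{1}_Q\Big\|_X\le C_3\|f\|_X.\] Then (a)$\Leftrightarrow$(b)$\Rightarrow$(c), and the optimal constants satisfy $C_2=C_3$ and $\max\{C_2,\widetilde C_2\}\le[X]_{\mathcal{G}}\le C_2\widetilde C_2$. If moreover $X\in A$, then (c) implies $X\in A_{\mathrm{strong}}$ with $[X]_{A_{\mathrm{strong}}}\le C_3[X]_A$.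
   Context: Cubes are axis-parallel cubes in $\mathbf{R}^d$. A Banach function space over $\mathbf{R}^d$ is a Banach space $X\subseteq L^0(\mathbf{R}^d)$ with the ideal property (if $f\in X$, $|g|\le|f|$ then $g\in X$, $\|g\|_X\le\|f\|_X$) and the saturation property (every set of positive measure contains a subset $F$ of positive measure with $\mathbf{1}_F\in X$). Köthe dual: $\|g\|_{X'}=\sup_{\|f\|_X=1}\int|fg|$. Fatou property: $0\le f_n\uparrow f$ a.e., $\sup\|f_n\|_X<\infty$ imply $f\in X$, $\|f\|_X=\sup\|f_n\|_X$. For a cube $Q$ with $\mathbf{1}_Q\in X$, $\|f\|_{X_Q}:=\|f\mathbf{1}_Q\|_X/\|\mathbf{1}_Q\|_X$. $X\in\mathcal{G}$ means there is $C$ such that for all pairwise disjoint collections of cubes $\mathcal{P}$ and $f\in X$, $g\in X'$: $\sum_{Q\in\mathcal{P}}\|f\mathbf{1}_Q\|_X\|g\mathbf{1}_Q\|_{X'}\le C\|f\|_X\|g\|_{X'}$; $[X]_{\mathcal{G}}$ is the least such $C$. $X\in A$ means $\mathbf{1}_Q\in X\cap X'$ for all cubes and $[X]_A:=\sup_Q|Q|^{-1}\|\mathbf{1}_Q\|_X\|\mathbf{1}_Q\|_{X'}<\infty$. With $\langle f\rangle_{1,Q}=\frac1{|Q|}\int_Q|f|$ and $A_{\mathcal{P}}f=\sum_{Q\in\mathcal{P}}\langle f\rangle_{1,Q}\mathbf{1}_Q$, $X\in A_{\mathrm{strong}}$ means there is $C$ with $\|A_{\mathcal{P}}f\|_X\le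 C\|f\|_X$ for all pairwise disjoint collections of cubes $\mathcal{P}$ and all $f\in X$; $[X]_{A_{\mathrm{strong}}}$ is the least such $C$.
   Formalization: It is assumed in addition that the indicator of every cube belongs to X; without this the quantity ‖f‖_{X_Q} in (b) and (c) is undefined (e.g. X = L^1(|x|^{-d}) satisfies (a), but 1_Q is not in X for cubes around 0). *)

(* Defs.v *)
From HB Require Import structures.
From mathcomp Require Import all_boot all_order all_algebra.
From mathcomp Require Import all_classical all_reals all_analysis.
Set Implicit Arguments. Unset Strict Implicit. Unset Printing Implicit Defensive.
Import Order.TTheory GRing.Theory Num.Theory.
Import numFieldNormedType.Exports.
Local Open Scope classical_set_scope.
Local Open Scope ring_scope.

(* R^d is modelled as d.-tuple R with its product (= Borel) sigma-algebra. *)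
Section BFS.
Variables (R : realType) (d : nat).
Local Notation T := (d.-tuple R).
Variable mu : {measure set T -> \bar R}.

(* mu is Lebesgue measure: its value on every half-open box is the product of
   the side lengths (this determines the Borel Lebesgue measure uniquely). *)
Definition hbox (a b : T) : set T :=
  [set x | forall i : 'I_d, tnth a i <= tnth x i < tnth b i].

Definition is_lebesgue : Prop :=
  forall a b : T, (forall i, tnth a i <= tnth b i) ->
    mu (hbox a b) = (\prod_(i < d) (tnth b i - tnth a i))%:E.

Definition is_cube (Q : set T) : Prop :=
  exists (a : T) (l : R), 0 < l /\
    Q = [set x | forall i : 'I_d, tnth a i <= tnth x i < tnth a i + l].

Definition cube_collection (P : set (set T)) : Prop :=
  (forall Q, P Q -> is_cube Q) /\ trivIset P id.

(* A Banach function space is given by its norm, extended by +oo outside X: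
   X = [set f | nrm f < +oo]. *)
Definition inX (nrm : (T -> R) -> \bar R) (f : T -> R) : Prop := (nrm f < +oo)%E.

Definition cauchy_in (nrm : (T -> R) -> \bar R) (u : nat -> T -> R) : Prop :=
  forall e : R, 0 < e -> exists N, forall n m, (N <= n)%N -> (N <= m)%N ->
    (nrm (fun x => (u n x - u m x)%R) < e%:E)%E.

Record is_BFS (nrm : (T -> R) -> \bar R) : Prop := {
  bfs_ge0 : forall f, (0 <= nrm f)%E;
  bfs_meas : forall f, inX nrm f -> measurable_fun setT f;
  bfs_eq0 : forall f, measurable_fun setT f ->
     (nrm f = 0%E <-> {ae mu, forall x, f x = 0});
  bfs_scale : forall (c : R) f, inX nrm f -> nrm (fun x => (c * f x)%R) = (`|c|%:E * nrm f)%E;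
  bfs_triangle : forall f g, inX nrm f -> inX nrm g -> (nrm (fun x => (f x + g x)%R) <= nrm f + nrm g)%E;
  bfs_complete : forall u : nat -> T -> R, (forall n, inX nrm (u n)) -> cauchy_in nrm u ->
     exists h, inX nrm h /\ forall e : R, 0 < e -> exists N, forall n, (N <= n)%N ->
       (nrm (fun x => (u n x - h x)%R) < e%:E)%E;
  bfs_ideal : forall f g : T -> R, inX nrm f -> measurable_fun setT g ->
     {ae mu, forall x, `|g x| <= `|f x|} -> inX nrm g /\ (nrm g <= nrm f)%E;
  bfs_saturation : forall E, measurable E -> (0 < mu E)%E ->
     exists F, [/\ measurable F, F `<=` E, (0 < mu F)%E & inX nrm (\1_F)]
}.

Definition fatou_prop (nrm : (T -> R) -> \bar R) : Prop :=
  forall (u : nat -> T -> R) (f : T -> R),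
    (forall n, inX nrm (u n)) -> measurable_fun setT f ->
    {ae mu, forall x, forall n, 0 <= u n x <= u n.+1 x} ->
    {ae mu, forall x, u ^~ x @ \oo --> f x} ->
    (exists M : R, forall n, (nrm (u n) <= M%:E)%E) ->
    inX nrm f /\ nrm f = ereal_sup (range (fun n => nrm (u n))).

Definition dnrm (nrm : (T -> R) -> \bar R) (g : T -> R) : \bar R :=
  ereal_sup [set (\int[mu]_x (`|f x * g x|)%:E)%E | f in [set f | nrm f = 1%E]].

Definition inXd (nrm : (T -> R) -> \bar R) (g : T -> R) : Prop :=
  measurable_fun setT g /\ (dnrm nrm g < +oo)%E.

Definition G_bound (nrm : (T -> R) -> \bar R) (C : R) : Prop :=
  forall P, cube_collection P -> forall f g : T -> R, inX nrm f -> inXd nrm g ->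
    (\esum_(Q in P) (nrm (fun x => (f x * \1_Q x)%R) * dnrm nrm (fun x => (g x * \1_Q x)%R))
       <= C%:E * nrm f * dnrm nrm g)%E.

Definition in_G nrm : Prop := exists C, G_bound nrm C.
Definition G_const nrm : \bar R := ereal_inf [set C%:E | C in G_bound nrm].

Definition A_quantity nrm (Q : set T) : \bar R :=
  ((fine (mu Q))^-1%:E * nrm (\1_Q) * dnrm nrm (\1_Q))%E.

Definition in_A nrm : Prop :=
  (forall Q, is_cube Q -> inX nrm (\1_Q) /\ inXd nrm (\1_Q)) /\
  (ereal_sup [set A_quantity nrm Q | Q in is_cube] < +oo)%E.

Definition A_const nrm : \bar R := ereal_sup [set A_quantity nrm Q | Q in is_cube].

Definition avg1 (f : T -> R) (Q : set T) : \bar R :=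
  ((fine (mu Q))^-1%:E * \int[mu]_(x in Q) (`|f x|)%:E)%E.

Definition A_op (P : set (set T)) (f : T -> R) : T -> R :=
  fun x => fine (\esum_(Q in P) (avg1 f Q * (\1_Q x)%:E))%E.

Definition Astrong_bound nrm (C : R) : Prop :=
  forall P, cube_collection P -> forall f, inX nrm f ->
    (nrm (A_op P f) <= C%:E * nrm f)%E.

Definition in_Astrong nrm : Prop := exists C, Astrong_bound nrm C.
Definition Astrong_const nrm : \bar R := ereal_inf [set C%:E | C in Astrong_bound nrm].

Definition nrmXQ nrm (f : T -> R) (Q : set T) : R :=
  fine (nrm (fun x => (f x * \1_Q x)%R)) / fine (nrm (\1_Q)).

Definition S_op nrm (P : set (set T)) (f : T -> R) : T -> R :=
  fun x => fine (\esum_(Q in P) (nrmXQ nrm f Q * \1_Q x)%:E).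

Definition supported_in (f : T -> R) (P : set (set T)) : Prop :=
  {ae mu, forall x, ~ (\bigcup_(Q in P) Q) x -> f x = 0}.

Definition b_upper nrm (C : R) : Prop :=
  forall P, cube_collection P -> forall f, inX nrm f -> supported_in f P ->
    (nrm (S_op nrm P f) <= C%:E * nrm f)%E.

Definition b_lower nrm (C : R) : Prop :=
  forall P, cube_collection P -> forall f, inX nrm f -> supported_in f P ->
    (C^-1%:E * nrm f <= nrm (S_op nrm P f))%E.

Definition c_bound nrm (C : R) : Prop :=
  forall P, cube_collection P -> forall f, inX nrm f ->
    (nrm (S_op nrm P f) <= C%:E * nrm f)%E.

Definition cond_b nrm : Prop :=
  exists C2 Ct2 : R, [/\ 0 < C2, 0 < Ct2, b_upper nrm C2 & b_lower nrm Ct2].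

Definition cond_c nrm : Prop := exists C3 : R, 0 < C3 /\ c_bound nrm C3.

Definition C2_opt nrm : \bar R := ereal_inf [set C%:E | C in [set C | 0 < C /\ b_upper nrm C]].
Definition Ct2_opt nrm : \bar R := ereal_inf [set C%:E | C in [set C | 0 < C /\ b_lower nrm C]].
Definition C3_opt nrm : \bar R := ereal_inf [set C%:E | C in [set C | 0 < C /\ c_bound nrm C]].

End BFS.

(* Main.v *)
Require Import Defs.
From HB Require Import structures.
From mathcomp Require Import finmap.
From mathcomp Require Import all_boot all_order all_algebra.
From mathcomp Require Import all_classical all_reals all_analysis.
From mathcomp Require Import measurable_realfun lra ring.
Set Implicit Arguments.
Unset Strict Implicit.
Unset Printing Implicit Defensive.
Import Order.TTheory GRing.Theory Num.Theory.
Import numFieldNormedType.Exports.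
Local Open Scope classical_set_scope.
Local Open Scope ring_scope.

(* The heart of the matter is the Lorentz-Luxemburg theorem: under the Fatou
   property the norm of X is recovered from X', i.e. nrm F <= C as soon as
   the integral of |F g| is at most C for every g in the unit ball of X'.  By
   the Fatou property one may truncate F to a bounded nonnegative f supported in
   a cube; if nrm f > C, then projecting f in L^2 onto the ball of radius C, which
   is convex, solid and closed under increasing limits, gives a point p <= f, and
   f - p >= 0 is a functional separating f from the ball.

   (a) => (b): test S f, resp. f, against g in the unit ball of X' and apply
   Hoelder's inequality on each cube; the norms of f and of S f agree on each cube.
   (b) => (a): on a finite subcollection replace f by the function
   h = sum_Q ||f 1_Q|| |phi_Q| 1_Q, where phi_Q nearly attains ||g 1_Q||_{X'}.
   Then S h <= S f, so ||h|| <= C2 Ct2 ||f||, while the integral of |h g| is nearly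
   the sum to be bounded.
   (c) => A_strong: <f>_{1,Q} <= [X]_A ||f||_{X_Q} by Hoelder's inequality on Q,
   so that A_P f <= [X]_A S f pointwise. *)

(** * Bounded functions vanishing outside a set of finite measure *)

Section bounded_finite_support.
Context (dT : measure_display) (T : measurableType dT) (R : realType).
Variables (mu : {measure set T -> \bar R}) (E : set T).
Hypotheses (mE : measurable E) (muE : (mu E < +oo)%E).

(** This class is stable under products and consists of integrable functions, so the L^2 arguments
    below run on real-valued integrals of squares, without an L^2 space. *)
Definition bsupp (u : T -> R) : Prop :=
  measurable_fun setT u /\ exists c, forall x, `|u x| <= c * \1_E x.

Lemma bsupp_indic : bsupp \1_E.
Proof.
split; first exact: measurable_indic.
by exists 1 => x; rewrite mul1r ger0_norm.
Qed.

Lemma bsuppD u v : bsupp u -> bsupp v -> bsupp (fun x => u x + v x).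
Proof.
move=> [mu_ [c uc]] [mv [e ve]]; split; first exact: measurable_funD.
exists (c + e) => x; rewrite mulrDl.
by rewrite (le_trans (ler_normD _ _))// lerD.
Qed.

Lemma bsuppB u v : bsupp u -> bsupp v -> bsupp (fun x => u x - v x).
Proof.
move=> [mu_ [c uc]] [mv [e ve]]; split; first exact: measurable_funB.
exists (c + e) => x; rewrite mulrDl.
by rewrite (le_trans (ler_normB _ _))// lerD.
Qed.

Lemma bsuppM u v : bsupp u -> bsupp v -> bsupp (fun x => u x * v x).
Proof.
move=> [mu_ [c uc]] [mv [e ve]]; split; first exact: measurable_funM.
exists (c * e) => x; rewrite normrM.
have -> : c * e * \1_E x = (c * \1_E x) * (e * \1_E x).
  by rewrite indicE; case: (x \in E); rewrite ?mulr1 ?mulr0.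
exact: ler_pM.
Qed.

Lemma bsuppX u : bsupp u -> bsupp (fun x => u x ^+ 2).
Proof. by move=> bu; rewrite (_ : (fun _ => _) = (fun x => u x * u x)) //; exact: bsuppM. Qed.

Lemma bsuppZ c u : bsupp u -> bsupp (fun x => c * u x).
Proof.
move=> [mu_ [e ue]]; split; first exact: measurable_funM.
by exists (`|c| * e) => x; rewrite normrM -mulrA ler_wpM2l.
Qed.

Lemma bsupp_norm u : bsupp u -> bsupp (fun x => `|u x|).
Proof.
move=> [mu_ [e ue]]; split; first exact: measurableT_comp.
by exists e => x; rewrite normr_id.
Qed.

Lemma bsupp_le (u v : T -> R) : bsupp v -> measurable_fun setT u ->
  (forall x, `|u x| <= `|v x|) -> bsupp u.
Proof.
move=> [_ [c vc]] mu_ uv; split => //; exists c => x.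
exact: le_trans (uv x) (vc x).
Qed.

Lemma bsupp_integrable u : bsupp u -> mu.-integrable setT (EFin \o u).
Proof.
move=> [mu_ [c uc]].
apply: (@le_integrable _ _ _ _ _ _ _ (EFin \o (fun x => c * \1_E x))) => //.
- exact/measurable_EFinP.
- move=> x _ /=; rewrite lee_fin (le_trans (uc x))//.
  exact: ler_norm.
have : mu.-integrable setT (fun x => (c%:E * (EFin \o \1_E) x)%E).
  apply: integrableZl => //; apply/integrableP; split.
    by apply/measurable_EFinP; exact: measurable_indic.
  under eq_integral => x _ do rewrite /= ger0_norm//.
  by rewrite integral_indic// setIT.
by [].
Qed.

Lemma bsupp_integralE u : bsupp u ->
  (\int[mu]_x (u x)%:E)%E = (\int[mu]_x u x)%:E.
Proof.
by move=> /bsupp_integrable /integrable_fin_num => /(_ measurableT) fi; rewrite /Rintegral fineK.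
Qed.

End bounded_finite_support.

(** Telescoping bounds [u n - u m], for [m >= n], by the total variation of the sequence after [n],
    and the bound passes to the infimum over [m]. The series stays in the extended reals because it
    may diverge. *)
Lemma infs_ge_series (R : realType) (u : nat -> R) n :
  has_lbound (range u) ->
  ((u n)%:E <= (infs u n)%:E +
     \sum_(0 <= k <oo) `|u (n + k).+1 - u (n + k)%N|%:E)%E.
Proof.
move=> lbu; set S := (\sum_(0 <= k <oo) _)%E.
have S0 : (0 <= S)%E by apply: nneseries_ge0.
case: (ltP S +oo%E) => [Soo|]; last first.
  by rewrite leye_eq => /eqP ->; rewrite addey// leey.
have Sf : S \is a fin_num by rewrite ge0_fin_numE.
rewrite -(fineK Sf) -EFinD lee_fin -lerBlDr.
apply: lb_le_inf; first by exists (u n); exists n => /=.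
move=> _ [m /= nm <-].
rewrite lerBlDr -lerBlDl -lee_fin fineK//.
rewrite -(subnKC nm); set j := (m - n)%N.
apply: (@le_trans _ _ (\sum_(0 <= k < j) `|u (n + k).+1 - u (n + k)%N|%:E)%E); last first.
  exact: nneseries_lim_ge.
rewrite sumEFin lee_fin; elim: j => [|j IH].
  by rewrite addn0 subrr big_geq.
rewrite big_nat_recr//= addnS.
have := ler_norm (- (u (n + j).+1 - u (n + j)%N)); rewrite normrN; lra.
Qed.

(** * L^2 projection onto a convex solid set closed under increasing limits *)

Section solid_projection.
Context (dT : measure_display) (T : measurableType dT) (R : realType).
Variables (mu : {measure set T -> \bar R}) (E : set T).
Hypotheses (mE : measurable E) (muE : (mu E < +oo)%E).
Variable K : (T -> R) -> Prop.
Hypothesis Kmeas : forall h, K h -> measurable_fun setT h.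
Hypothesis Kge0 : forall h, K h -> forall x, 0 <= h x.
Hypothesis K0 : K (fun=> 0).
Hypothesis Kconv : forall (h k : T -> R) (t : R), K h -> K k -> 0 <= t <= 1 ->
  K (fun x => (1 - t) * h x + t * k x).
Hypothesis Ksolid : forall h k : T -> R, K h -> measurable_fun setT k ->
  (forall x, 0 <= k x <= h x) -> K k.
Hypothesis Ksup : forall (u : nat -> T -> R) (k : T -> R), (forall n : nat, K (u n)) ->
  (forall x n, u n x <= u n.+1 x) -> (forall x, u ^~ x @ \oo --> k x) -> K k.
Variable f : T -> R.
Hypothesis bf : bsupp E f.

(** Only members of [K] below [f] compete for the minimum: they inherit boundedness and support from
    [f], so [J] is an honest finite integral on all of them. *)
Let Kf h := K h /\ forall x, h x <= f x.
Let J h := \int[mu]_x ((f x - h x) ^+ 2).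

Let Kf_bsupp h : Kf h -> bsupp E h.
Proof.
move=> [Kh hf]; apply: (bsupp_le bf (Kmeas Kh)) => x.
have h0 := Kge0 Kh x.
by rewrite !ger0_norm//; exact: le_trans (hf x).
Qed.

Let J_bsupp h : Kf h -> bsupp E (fun x => (f x - h x) ^+ 2).
Proof. by move=> /Kf_bsupp bh; exact/bsuppX/bsuppB. Qed.

Let J_ge0 h : 0 <= J h.
Proof. by apply: Rintegral_ge0 => x _; exact: sqr_ge0. Qed.

Let delta := inf [set J h | h in Kf].

Let J_lbound : has_lbound [set J h | h in Kf].
Proof. by exists 0 => _ [h _ <-]; exact: J_ge0. Qed.

Let delta_le h : Kf h -> delta <= J h.
Proof. by move=> Kh; apply: ge_inf => //; exists h. Qed.

Let f_ge0_of h : Kf h -> forall x, 0 <= f x.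
Proof. by move=> [Kh hf] x; apply: le_trans (hf x); exact: Kge0. Qed.

(* The parallelogram identity makes a minimising sequence Cauchy. *)
Let near_minimisers h k e : Kf h -> Kf k -> J h < delta + e -> J k < delta + e ->
  \int[mu]_x ((h x - k x) ^+ 2) <= 4 * e.
Proof.
move=> Kh Kk Jh Jk.
pose m x := (1 - 2^-1) * h x + 2^-1 * k x.
have Km : Kf m.
  split; first by apply: Kconv; [exact: Kh.1|exact: Kk.1|lra].
  by move=> x; rewrite /m; have := Kh.2 x; have := Kk.2 x; lra.
have Jm := delta_le Km.
have bhk : bsupp E (fun x => (h x - k x) ^+ 2).
  by apply/bsuppX/bsuppB; exact: Kf_bsupp.
have bI := bsupp_integrable mE muE.
have : \int[mu]_x ((h x - k x) ^+ 2 + 4 * (f x - m x) ^+ 2) =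
       \int[mu]_x (2 * (f x - h x) ^+ 2 + 2 * (f x - k x) ^+ 2).
  by apply: eq_Rintegral => x _; rewrite /m; field.
rewrite RintegralD//; [|exact: bI|apply: bI; exact/bsuppZ/J_bsupp].
rewrite RintegralD//; [|apply: bI; exact/bsuppZ/J_bsupp..].
rewrite !RintegralZl//; [|apply: bI; exact: J_bsupp..].
by rewrite -/(J h) -/(J k) -/(J m); lra.
Qed.

(** The L^2 bound becomes an L^1 bound through [|w| <= s * w ^+ 2 + s^-1] on [E], a consequence of
    [(s * |w| - 1) ^+ 2 >= 0]. With the excess [(s ^+ 2)^-1] both terms integrate to a multiple of
    [s^-1]. *)
Let near_minimisers_L1 h k s : 0 < s -> Kf h -> Kf k ->
  J h < delta + (s ^+ 2)^-1 -> J k < delta + (s ^+ 2)^-1 ->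
  \int[mu]_x `|h x - k x| <= (4 + fine (mu E)) / s.
Proof.
move=> s0 Kh Kk Jh Jk.
have L2 := near_minimisers Kh Kk Jh Jk.
have bI := bsupp_integrable mE muE.
have bhk : bsupp E (fun x => h x - k x) by apply/bsuppB; exact: Kf_bsupp.
have bE : bsupp E (\1_E : T -> R) by exact: bsupp_indic.
apply: (@le_trans _ _ (\int[mu]_x (s * (h x - k x) ^+ 2 + s^-1 * \1_E x))).
  apply: le_Rintegral => //; first by apply: bI; exact: bsupp_norm.
    by apply: bI; apply: bsuppD; [exact/bsuppZ/bsuppX|exact/bsuppZ].
  move=> x _; have [c hc] := bhk.2; move: (hc x); rewrite indicE.
  case: (x \in E) => /=; last first.
    by rewrite !mulr0 addr0 normr_le0 => /eqP ->; rewrite normr0 expr0n mulr0.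
  move=> _; rewrite mulr1 -(real_normK (num_real (h x - k x))).
  set w := `|_|; have : 0 <= (s * w - 1) ^+ 2 by exact: sqr_ge0.
  have si : 0 < s^-1 by rewrite invr_gt0.
  have w0 : 0 <= w by exact: normr_ge0.
  move=> /(mulr_ge0 (ltW si)).
  have -> : s^-1 * (s * w - 1) ^+ 2 = s * w ^+ 2 - 2 * w + s^-1.
    by field; rewrite gt_eqF.
  lra.
rewrite RintegralD//; [|apply: bI; exact/bsuppZ/bsuppX|apply: bI; exact/bsuppZ].
rewrite !RintegralZl//; [|exact: bI|apply: bI; exact/bsuppX].
have -> : \int[mu]_x \1_E x = fine (mu E) by rewrite /Rintegral integral_indic// setIT.
rewrite mulrDl (mulrC (fine _)) lerD2r.
apply: le_trans (ler_wpM2l (ltW s0) L2) _.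
by rewrite le_eqVlt; apply/orP; left; apply/eqP; field; rewrite gt_eqF.
Qed.

(** A fast minimising sequence has summable L^1 increments, but [K] is closed under increasing
    limits only. The sequence is therefore replaced by its tail infima, which lie in [K] by
    solidity, increase with the index, and raise [J] by an amount tending to 0. *)
Lemma solid_projection_exists : (forall x, 0 <= f x) ->
  exists p, Kf p /\ forall h, Kf h -> J p <= J h.
Proof.
move=> f0.
have hasJ : has_inf [set J h | h in Kf].
  by split => //; exists (J (fun=> 0)); exists (fun=> 0).
have minE n : exists h, Kf h /\ J h < delta + ((2 ^+ n) ^+ 2)^-1.
  have e0 : 0 < ((2 ^+ n) ^+ 2)^-1 :> R by rewrite invr_gt0 !exprn_gt0.
  by have [_ [h Kh <-] lt] := inf_adherent e0 hasJ; exists h.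
have [h hP] := choice minE.
have Kh n : Kf (h n) by have [] := hP n.
have Jh n : J (h n) < delta + ((2 ^+ n) ^+ 2)^-1 by have [] := hP n.
have mh n : measurable_fun setT (h n) by exact: Kmeas (Kh n).1.
have lbh x : has_lbound (range (h ^~ x)).
  by exists 0 => _ [n _ <-]; exact: Kge0 (Kh n).1 _.
have [c fc] := bf.2.
pose M := `|c| + 1.
have M0 : 0 < M by rewrite /M; have := normr_ge0 c; lra.
have fM x : f x <= M.
  apply: le_trans (ler_norm _) _; apply: le_trans (fc x) _.
  rewrite /M indicE; case: (x \in E); rewrite ?mulr1 ?mulr0; have := ler_norm c;
    have := normr_ge0 c; lra.
pose q n x := infs (h ^~ x) n.
have q_ge0 n x : 0 <= q n x.
  apply: lb_le_inf; first by exists (h n x); exists n => /=.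
  by move=> _ [k _ <-]; exact: Kge0 (Kh k).1 _.
have q_le n x : q n x <= h n x.
  apply: ge_inf; last by exists n => /=.
  by exists 0 => _ [k _ <-]; exact: Kge0 (Kh k).1 _.
have mq n : measurable_fun setT (q n) by exact: measurable_fun_infs.
have Kq n : Kf (q n).
  split; last by move=> x; apply: le_trans (q_le n x) _; exact: (Kh n).2.
  by apply: (Ksolid (Kh n).1 (mq n)) => x; rewrite q_ge0 q_le.
pose D n x := (\sum_(0 <= k <oo) `|h (n + k).+1 x - h (n + k)%N x|%:E)%E.
(* The factor 2 matches the weights [2 ^- k.+1] of [epsilon_trick0], while the L^1 bounds decay like
   [2 ^- (n + k)]. *)
pose C := 2 * (4 + fine (mu E)).
have mE0 : 0 <= fine (mu E) by exact: fine_ge0.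
have C0 : 0 <= C by rewrite /C; lra.
have mdiff n : measurable_fun setT (fun x => `|h n.+1 x - h n x|%:E).
  by apply/measurable_EFinP; apply: measurableT_comp => //; exact: measurable_funB.
have intD n : (\int[mu]_x D n x <= (C / 2 ^+ n)%:E)%E.
  rewrite integral_nneseries//.
  apply: le_trans (epsilon_trick0 xpredT _); last by rewrite divr_ge0// exprn_ge0.
  apply: lee_nneseries => [k _ _|k _]; first exact: integral_ge0.
  have bhk : bsupp E (fun x => `|h (n + k).+1 x - h (n + k)%N x|).
    by apply/bsupp_norm/bsuppB; exact: Kf_bsupp.
  rewrite (bsupp_integralE mE muE bhk) lee_fin.
  have s0 : 0 < (2 : R) ^+ (n + k) by rewrite exprn_gt0.
  apply: le_trans (near_minimisers_L1 s0 (Kh _) (Kh _) _ (Jh _)) _.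
    apply: lt_le_trans (Jh _) _; rewrite lerD2l lef_pV2 ?posrE ?exprn_gt0//.
    by rewrite (exprS 2 (n + k)); have := s0; nra.
  rewrite le_eqVlt; apply/orP; left; apply/eqP; rewrite /C natrX exprS exprD; field.
  by rewrite !expf_neq0.
(* Pointwise, [(f - q) ^+ 2 - (f - h) ^+ 2 = (h - q) * (2 * f - h - q)], where the first factor is
   at most [D n] and the second at most [2 * M]. *)
have Jq n : J (q n) <= J (h n) + 2 * M * (C / 2 ^+ n).
  have bh := J_bsupp (Kh n); have bq := J_bsupp (Kq n).
  rewrite -lee_fin EFinD EFinM -(bsupp_integralE mE muE bq) -(bsupp_integralE mE muE bh).
  apply: (@le_trans _ _ (\int[mu]_x (((f x - h n x) ^+ 2)%:E + (2 * M)%:E * D n x))%E).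
    have mD : measurable_fun setT (D n) by exact: ge0_emeasurable_sum.
    apply: ge0_le_integral => //.
    - by move=> x _; rewrite lee_fin sqr_ge0.
    - by apply/measurable_EFinP; exact: bq.1.
    - apply: emeasurable_funD; first by apply/measurable_EFinP; exact: bh.1.
      exact: emeasurable_funM.
    move=> x _.
    have := @infs_ge_series _ (h ^~ x) n (lbh x); rewrite -/(q n x) -/(D n x).
    have : (0 <= D n x)%E by apply: nneseries_ge0.
    case: (D n x) => [r| |]//; last first.
      by move=> _ _; rewrite gt0_muley ?lte_fin ?mulr_gt0// addey// leey.
    rewrite -EFinM -!EFinD !lee_fin => r0 hq.
    have := q_le n x; have := q_ge0 n x; have := (Kh n).2 x; have := fM x.
    nra.
  rewrite ge0_integralD//; last 4 first.
  - by move=> x _; rewrite lee_fin sqr_ge0.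
  - by apply/measurable_EFinP; exact: bh.1.
  - move=> x _; apply: mule_ge0; first by rewrite lee_fin mulr_ge0// ltW.
    by apply: nneseries_ge0.
  - by apply: emeasurable_funM => //; exact: ge0_emeasurable_sum.
  rewrite leeD2l// ge0_integralZl//; last 3 first.
  - exact: ge0_emeasurable_sum.
  - by move=> x _; apply: nneseries_ge0.
  - by rewrite lee_fin mulr_ge0// ltW.
  by rewrite lee_wpmul2l// lee_fin mulr_ge0// ltW.
pose p x := sup (range (q ^~ x)).
have ubh x : has_ubound (range (h ^~ x)).
  by exists (f x) => _ [n _ <-]; exact: (Kh n).2.
have qp x : q ^~ x @ \oo --> p x by exact: cvg_infs_sup.
have qnd x n : q n x <= q n.+1 x by apply: nondecreasing_infs.
have ubq x : has_ubound (range (q ^~ x)).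
  by exists (f x) => _ [n _ <-]; exact: (Kq n).2.
have q_le_p n x : q n x <= p x by apply: ub_le_sup => //; exists n.
have Kp : Kf p.
  split; first by apply: (Ksup (fun n => (Kq n).1)).
  move=> x; apply: ge_sup; first by exists (q 0%N x); exists 0%N.
  by move=> _ [n _ <-]; exact: (Kq n).2.
exists p; split => // k Kk; apply: le_trans (delta_le Kk).
apply/ler_addgt0Pr => e e0.
(* Since [q n <= p <= f], the limit is pointwise closer to [f] than each [q n]. *)
have Jpq n : J p <= J (q n).
  apply: le_Rintegral => //; [exact: bsupp_integrable (J_bsupp Kp)|
    exact: bsupp_integrable (J_bsupp (Kq n))|move=> x _].
  have := q_le_p n x; have := Kp.2 x; nra.
(* [B / 2 ^+ n] dominates the sum of both errors: the excess [4 ^- n <= 2 ^- n] of [h n], and the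
   cost of passing to [q n]. *)
pose B := 1 + 2 * M * C.
have B0 : 0 < B by rewrite /B; have : 0 <= M * C by [rewrite mulr_ge0// ltW]; lra.
have [n nB] : exists n, B / e < 2 ^+ n.
  exists (Num.bound (B / e)).
  apply: lt_le_trans (archi_boundP _) _; first by rewrite divr_ge0// ltW.
  by rewrite -natrX ler_nat ltnW// ltn_expl.
have s1 : 1 <= (2 : R) ^+ n by rewrite exprn_ege1//; lra.
have s0 : 0 < (2 : R) ^+ n by rewrite exprn_gt0.
have : J p < delta + ((2 ^+ n) ^+ 2)^-1 + 2 * M * (C / 2 ^+ n).
  by apply: le_lt_trans (Jpq n) _; apply: le_lt_trans (Jq n) _; rewrite ltrD2r.
have : B / 2 ^+ n < e by rewrite ltr_pdivrMr// mulrC -ltr_pdivrMr.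
have : ((2 ^+ n) ^+ 2)^-1 <= (2 ^+ n)^-1 :> R.
  by rewrite lef_pV2 ?posrE ?exprn_gt0//; nra.
rewrite /B mulrDl div1r !mulrA; lra.
Qed.

(** The segment from [p] to [h] may leave the region below [f]. Cutting it off at [f] keeps it in
    [K] by solidity and can only reduce the distance to [f], so minimality of [p] still yields the
    usual inequality [2 * A <= t * B] for small [t]. *)
Let first_variation p h : Kf p -> (forall k, Kf k -> J p <= J k) ->
  K h -> bsupp E h ->
  \int[mu]_x ((f x - p x) * h x) <= \int[mu]_x ((f x - p x) * p x).
Proof.
move=> Kp minp Kh bh.
have bI := bsupp_integrable mE muE.
have bp := Kf_bsupp Kp.
have bg : bsupp E (fun x => f x - p x) by exact: bsuppB.
have bv : bsupp E (fun x => h x - p x) by exact: bsuppB.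
rewrite -subr_le0 -RintegralB//; [|apply: bI; exact: bsuppM..].
under eq_Rintegral => x _ do rewrite -mulrBr.
set A := \int[mu]_x _; set B := \int[mu]_x ((h x - p x) ^+ 2).
have B0 : 0 <= B by apply: Rintegral_ge0 => x _; exact: sqr_ge0.
have key t : 0 < t -> t <= 1 -> 2 * A <= t * B.
  move=> t0 t1.
  pose m x := (1 - t) * p x + t * h x.
  have Km : K m by apply: Kconv => //; [exact: Kp.1|lra].
  pose q x := Num.min (f x) (m x).
  have q_ge0 x : 0 <= q x.
    by rewrite /q le_min (f_ge0_of Kp) Kge0.
  have Kq : Kf q.
    split; last by move=> x; rewrite /q ge_min lexx.
    apply: (Ksolid Km); first exact: measurable_minr bf.1 (Kmeas Km).
    by move=> x; rewrite q_ge0 /q ge_min lexx orbT.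
  have := minp _ Kq; rewrite /J.
  have bpt : bsupp E (fun x => (2 * t) * ((f x - p x) * (h x - p x))) by exact/bsuppZ/bsuppM.
  have bq2 : bsupp E (fun x => t ^+ 2 * (h x - p x) ^+ 2) by exact/bsuppZ/bsuppX.
  have bJp := J_bsupp Kp.
  have : \int[mu]_x ((f x - q x) ^+ 2) <=
      \int[mu]_x ((f x - p x) ^+ 2 - (2 * t) * ((f x - p x) * (h x - p x)) +
        t ^+ 2 * (h x - p x) ^+ 2).
    apply: le_Rintegral => //; first by apply: bI; exact: J_bsupp.
      by apply: bI; apply: bsuppD => //; apply: bsuppB.
    move=> x _; have -> : (f x - p x) ^+ 2 - (2 * t) * ((f x - p x) * (h x - p x)) +
        t ^+ 2 * (h x - p x) ^+ 2 = (f x - m x) ^+ 2 by rewrite /m; ring.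
    rewrite /q; have [fm|mf] := leP (f x) (m x).
      by rewrite subrr expr0n sqr_ge0.
    exact: lexx.
  rewrite RintegralD//; [|apply: bI; exact: bsuppB|exact: bI].
  rewrite RintegralB//; [|exact: bI..].
  rewrite !RintegralZl//; [|apply: bI; exact: bsuppX|apply: bI; exact: bsuppM].
  rewrite -/A -/B => le1 le2.
  have : 0 <= t * (t * B - 2 * A) by lra.
  by rewrite pmulr_rge0// subr_ge0.
rewrite leNgt; apply/negP => A0.
(* For [t = A / (A + B)] one has [t * B = A - t * A < A], against [2 * A <= t * B]. This choice is
   at most 1 and also covers [B = 0]. *)
have t0 : 0 < A / (A + B) by rewrite divr_gt0//; lra.
have t1 : A / (A + B) <= 1 by rewrite ler_pdivrMr; lra.
have := key _ t0 t1.
have -> : A / (A + B) * B = A - A * (A / (A + B)) by field; rewrite gt_eqF//; lra.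
have : 0 < A * (A / (A + B)) by rewrite mulr_gt0.
lra.
Qed.

(* Separation of [f] from [K] by the nonnegative function [f - p], where [p] is
   the point of [K] below [f] closest to [f] in L^2. *)
Lemma solid_separation : (forall x, 0 <= f x) ->
  exists p, [/\ K p, forall x, p x <= f x &
    forall h, K h -> (\int[mu]_x ((f x - p x) * h x)%:E
                      <= \int[mu]_x ((f x - p x) * p x)%:E)%E].
Proof.
move=> f0; have [p [Kp minp]] := solid_projection_exists f0.
exists p; split; [exact: Kp.1|exact: Kp.2|move=> h Kh].
have bp := Kf_bsupp Kp.
have bg : bsupp E (fun x => f x - p x) by exact: bsuppB.
have h_ge0 := Kge0 Kh.
have g_ge0 x : 0 <= f x - p x by rewrite subr_ge0; exact: Kp.2.
(* A member of [K] need not be bounded or vanish off [E], so the first variation is applied to its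
   truncations. Monotone convergence recovers [h], since [f - p] vanishes off [E]. *)
pose hN n x := Num.min (h x) (n%:R * \1_E x).
have hN_ge0 n x : 0 <= hN n x by rewrite le_min h_ge0 mulr_ge0.
have mhN n : measurable_fun setT (hN n).
  apply: measurable_minr; first exact: Kmeas.
  by apply: measurable_funM => //; exact: measurable_indic.
have bhN n : bsupp E (hN n).
  split => //; exists n%:R => x; rewrite ger0_norm//.
  by rewrite /hN ge_min lexx orbT.
have KhN n : K (hN n).
  by apply: (Ksolid Kh) => // x; rewrite hN_ge0 /hN ge_min lexx.
pose G n x := ((f x - p x) * hN n x)%:E.
have mG n : measurable_fun setT (G n).
  by apply/measurable_EFinP; exact: measurable_funM bg.1 (mhN n).
have G0 n x : (0 <= G n x)%E by rewrite lee_fin mulr_ge0.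
have ndG x : {homo G^~ x : n m / (n <= m)%N >-> (n <= m)%E}.
  move=> n m nm; rewrite lee_fin ler_wpM2l//.
  rewrite /hN le_min ge_min lexx /= ge_min; apply/orP; right.
  by rewrite ler_wpM2r// ler_nat.
have cvG := @cvg_monotone_convergence _ _ _ mu setT measurableT G mG
  (fun n x _ => G0 n x) (fun x _ => ndG x).
have limG x : limn (G^~ x) = ((f x - p x) * h x)%:E.
  apply/cvg_lim => //; apply: cvg_near_cst.
  exists (Num.bound (h x)) => // n /= nb; rewrite /G; congr EFin.
  have [c gc] := bg.2; have := gc x; rewrite /hN indicE; case: (x \in E) => /=.
    move=> _; congr (_ * _); apply/min_idPl; rewrite mulr1.
    apply: le_trans (ltW (archi_boundP (h_ge0 x))) _.
    by rewrite ler_nat.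
  by rewrite mulr0 normr_le0 => /eqP ->; rewrite !mul0r.
rewrite (eq_integral (fun x => limn (G^~ x))); last by move=> x _; rewrite limG.
move/cvg_lim : (cvG) => <-//.
apply: lime_le; first by apply/cvg_ex; eexists; exact: cvG.
apply: nearW => n.
rewrite /G (bsupp_integralE mE muE); last exact: bsuppM.
rewrite (bsupp_integralE mE muE); last exact: bsuppM.
by rewrite lee_fin; exact: first_variation.
Qed.

End solid_projection.

(** * Cubes: measure, countability of disjoint collections, exhaustion of the space *)

Section cubes.
Variables (R : realType) (d : nat).
Local Notation T := (d.-tuple R).
Variable mu : {measure set T -> \bar R}.
Hypothesis lebmu : is_lebesgue mu.

Lemma measurable_hbox (a b : T) : measurable (hbox a b).
Proof.
have -> : hbox a b = \big[setI/setT]_(i < d)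
    ((fun x : T => tnth x i) @^-1` `[tnth a i, tnth b i[%classic).
  apply/seteqP; split => [x xab|x].
    apply: (big_ind (fun A : set T => A x)) => // i _ /=.
    by rewrite in_itv /= xab.
  by move=> + i; rewrite (bigD1 i)//= => -[+ _]; rewrite in_itv.
apply: bigsetI_measurable => i _.
by rewrite -[X in measurable X]setTI; apply: measurable_tnth.
Qed.

Lemma cubeE (Q : set T) : is_cube Q -> exists (a : T) (l : R), 0 < l /\
  Q = hbox a [tuple tnth a i + l | i < d].
Proof.
move=> [a [l [l0 ->]]]; exists a, l; split => //.
apply/seteqP; split => x xQ i; first by rewrite tnth_mktuple; exact: xQ.
by have := xQ i; rewrite tnth_mktuple.
Qed.

Lemma measurable_cube (Q : set T) : is_cube Q -> measurable Q.
Proof. by move=> /cubeE[a [l [_ ->]]]; exact: measurable_hbox. Qed.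

Lemma cube_measure (Q : set T) : is_cube Q -> exists m : R, 0 < m /\ mu Q = m%:E.
Proof.
move=> /cubeE[a [l [l0 ->]]]; exists (l ^+ d); split; first exact: exprn_gt0.
rewrite lebmu; last by move=> i; rewrite tnth_mktuple lerDl ltW.
congr EFin; rewrite -[in RHS](card_ord d) -prodr_const.
by apply: eq_bigr => i _; rewrite tnth_mktuple addrC addKr.
Qed.

Lemma cube_rat (Q : set T) : is_cube Q ->
  exists r : d.-tuple rat, Q [tuple ratr (tnth r i) | i < d].
Proof.
move=> [a [l [l0 ->]]].
have ex i : exists r : rat, tnth a i <= ratr r < tnth a i + l.
  have [|q] := @rat_in_itvoo R (tnth a i) (tnth a i + l); first by rewrite ltrDl.
  by rewrite in_itv /= => /andP[/ltW aq ql]; exists q; rewrite aq.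
have [r rP] := choice ex.
by exists [tuple r i | i < d] => i; rewrite !tnth_mktuple.
Qed.

(** Each cube contains a point with rational coordinates, and by disjointness this point determines
    the cube. *)
Lemma cube_collection_countable P : @cube_collection R d P -> countable P.
Proof.
move=> [Pc tP].
have ex Q : exists r : d.-tuple rat, P Q -> Q [tuple ratr (tnth r i) | i < d].
  have [/Pc/cube_rat[r rQ]|nPQ] := pselect (P Q); first by exists r.
  by exists [tuple 0 | i < d] => /nPQ.
have [r rP] := choice ex.
apply/countable_injP; exists (pickle \o r) => Q Q' /set_mem PQ /set_mem PQ'.
move=> /(pcan_inj pickleK) rQ.
apply: tP => //; exists [tuple ratr (tnth (r Q) i) | i < d]; split.
  exact: rP.
by rewrite rQ; exact: rP.
Qed.

(** The shift to [n.+1] makes the cube of index 0 nondegenerate; it later serves as a test cube. *)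
Definition centred_cube (n : nat) : set T :=
  [set x | forall i : 'I_d, - n.+1%:R <= tnth x i < n.+1%:R].

Lemma centred_cubeP n : is_cube (centred_cube n).
Proof.
exists [tuple - n.+1%:R | i < d], (2 * n.+1%:R); split; first by rewrite mulr_gt0.
have e : - n.+1%:R + 2 * n.+1%:R = n.+1%:R :> R by ring.
apply/seteqP; split => x xQ i; first by rewrite tnth_mktuple e; exact: xQ.
by have := xQ i; rewrite tnth_mktuple e.
Qed.

Lemma centred_cube_nondecreasing n m : (n <= m)%N ->
  centred_cube n `<=` centred_cube m.
Proof.
move=> nm x xn i; have /andP[l r] := xn i.
have nm' : n.+1%:R <= m.+1%:R :> R by rewrite ler_nat.
by apply/andP; split; lra.
Qed.

Lemma centred_cube_cover x : exists n, centred_cube n x.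
Proof.
exists (\max_(i < d) Num.bound `|tnth x i|) => i.
have le1 : `|tnth x i| < (\max_(i < d) Num.bound `|tnth x i|).+1%:R.
  apply: lt_le_trans (archi_boundP (normr_ge0 _)) _.
  by rewrite ler_nat ltnW// ltnS (leq_bigmax i).
by move: le1; rewrite ltr_norml => /andP[l ->]; rewrite ltW.
Qed.

End cubes.

(** * Norm, dual norm, and separation of a function from a ball *)

Section banach_function_space.
Variables (R : realType) (d : nat).
Local Notation T := (d.-tuple R).
Variables (mu : {measure set T -> \bar R}) (nrm : (T -> R) -> \bar R).
Hypothesis BX : is_BFS mu nrm.
Local Notation X := (inX nrm).

Lemma nrm_mono (f g : T -> R) : X f -> measurable_fun setT g ->
  (forall x, `|g x| <= `|f x|) -> X g /\ (nrm g <= nrm f)%E.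
Proof. by move=> Xf mg gf; apply: (bfs_ideal BX) => //; exact: aeW. Qed.

Lemma inX_fin (f : T -> R) : X f -> nrm f \is a fin_num.
Proof. by move=> Xf; rewrite ge0_fin_numE//; exact: bfs_ge0 BX f. Qed.

Lemma nrm_fineK (f : T -> R) : X f -> (fine (nrm f))%:E = nrm f.
Proof. by move=> /inX_fin/fineK. Qed.

Lemma nrm0 : nrm (fun=> 0) = 0%E.
Proof. by apply/(bfs_eq0 BX) => //; exact: aeW. Qed.

Lemma inX0 : X (fun=> 0).
Proof. by rewrite /inX nrm0. Qed.

Lemma inXZ (c : R) (f : T -> R) : X f -> X (fun x => c * f x).
Proof.
move=> Xf; rewrite /inX (bfs_scale BX)// -(nrm_fineK Xf) -EFinM.
exact: ltry.
Qed.

Lemma inXD (f g : T -> R) : X f -> X g -> X (fun x => f x + g x).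
Proof.
move=> Xf Xg; apply: le_lt_trans (bfs_triangle BX Xf Xg) _.
by rewrite lte_add_pinfty.
Qed.

Lemma inX_sum (I : Type) (s : seq I) (u : I -> T -> R) :
  (forall i, X (u i)) -> X (fun x => \sum_(i <- s) u i x).
Proof.
move=> Xu; elim: s => [|i s IH].
  by under eq_fun do rewrite big_nil; exact: inX0.
by under eq_fun do rewrite big_cons; exact: inXD.
Qed.

Lemma nrm_norm (f : T -> R) : X f ->
  X (fun x => `|f x|) /\ nrm (fun x => `|f x|) = nrm f.
Proof.
move=> Xf; have mf := bfs_meas BX Xf.
have mnf : measurable_fun setT (fun x => `|f x|) by exact: measurableT_comp.
have [|Xn le1] := nrm_mono Xf mnf; first by move=> x; rewrite normr_id.
have [|_ le2] := nrm_mono Xn mf; first by move=> x; rewrite normr_id.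
by split => //; apply/eqP; rewrite eq_le le1.
Qed.

Lemma inX_indicM (f : T -> R) (Q : set T) : X f -> measurable Q ->
  X (fun x => f x * \1_Q x) /\ (nrm (fun x => f x * \1_Q x)%R <= nrm f)%E.
Proof.
move=> Xf mQ; apply: nrm_mono => //.
  by apply: measurable_funM; [exact: bfs_meas BX _ Xf|exact: measurable_indic].
move=> x; rewrite normrM indicE; case: (x \in Q) => /=; rewrite ?normr1 ?normr0 ?mulr1 ?mulr0//.
Qed.

(** The function [f] is scaled to norm one. Norm zero is separate: then [f] vanishes almost
    everywhere, and the right side is 0 even if the dual norm of [g] is infinite. *)
Lemma holder_dnrm (f g : T -> R) : X f -> measurable_fun setT g ->
  (\int[mu]_x (`|f x * g x|)%:E <= nrm f * dnrm mu nrm g)%E.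
Proof.
move=> Xf mg; have mf := bfs_meas BX Xf.
have mfg : measurable_fun setT (fun x => (`|f x * g x|)%:E).
  by apply/measurable_EFinP; apply: measurableT_comp => //; exact: measurable_funM.
have [f0|f0] := eqVneq (nrm f) 0%E.
  rewrite f0 mul0e (ge0_ae_eq_integral (g := fun=> 0%E))//; first by rewrite integral0.
  have := (bfs_eq0 BX mf).1 f0; apply: filterS => x fx0 _.
  by rewrite fx0 mul0r normr0.
set r := fine (nrm f).
have nE : nrm f = r%:E by rewrite nrm_fineK.
have r0 : 0 < r.
  by rewrite lt_neqAle eq_sym -eqe -nE f0 /= -lee_fin -nE; exact: bfs_ge0 BX f.
have n1 : nrm (fun x => r^-1 * f x) = 1%E.
  rewrite (bfs_scale BX)// nE -EFinM ger0_norm ?invr_ge0 ?ltW// mulVf//.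
  by rewrite gt_eqF.
have : (\int[mu]_x (`|(r^-1 * f x) * g x|)%:E <= dnrm mu nrm g)%E.
  by apply: ereal_sup_ubound; exists (fun x => r^-1 * f x).
have -> : (\int[mu]_x (`|(r^-1 * f x) * g x|)%:E =
           r^-1%:E * \int[mu]_x (`|f x * g x|)%:E)%E.
  rewrite -ge0_integralZl//; last by rewrite lee_fin invr_ge0 ltW.
  apply: eq_integral => x _; rewrite -EFinM -mulrA normrM ger0_norm//.
  by rewrite invr_ge0 ltW.
by rewrite nE muleC lee_pdivrMr// muleC.
Qed.

Lemma dnrm_le (g : T -> R) (c : \bar R) :
  (forall f, nrm f = 1%E -> (\int[mu]_x (`|f x * g x|)%:E <= c)%E) ->
  (dnrm mu nrm g <= c)%E.
Proof. by move=> H; apply: ge_ereal_sup => _ [f /= f1 <-]; exact: H. Qed.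

Lemma dnrm_mono (f g : T -> R) : measurable_fun setT f -> measurable_fun setT g ->
  (forall x, `|g x| <= `|f x|) -> (dnrm mu nrm g <= dnrm mu nrm f)%E.
Proof.
move=> mf mg gf; apply: dnrm_le => h h1.
have mh : measurable_fun setT h by apply: (bfs_meas BX); rewrite /inX h1 ltry.
apply: (@le_trans _ _ (\int[mu]_x (`|h x * f x|)%:E)%E).
  apply: ge0_le_integral => //.
  - by apply/measurable_EFinP; apply: measurableT_comp => //; exact: measurable_funM.
  - by apply/measurable_EFinP; apply: measurableT_comp => //; exact: measurable_funM.
  - by move=> x _; rewrite lee_fin !normrM ler_wpM2l.
by apply: ereal_sup_ubound; exists h.
Qed.

Lemma dnrm_indicM (g : T -> R) (Q : set T) : measurable_fun setT g -> measurable Q ->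
  (dnrm mu nrm (fun x => g x * \1_Q x)%R <= dnrm mu nrm g)%E.
Proof.
move=> mg mQ; apply: dnrm_mono => //.
  by apply: measurable_funM => //; exact: measurable_indic.
move=> x; rewrite normrM indicE; case: (x \in Q) => /=; rewrite ?normr1 ?normr0 ?mulr1 ?mulr0//.
Qed.

Hypothesis FX : fatou_prop mu nrm.

Let ball (C : R) (h : T -> R) : Prop :=
  [/\ measurable_fun setT h, forall x, 0 <= h x & (nrm h <= C%:E)%E].

Let ball_inX C h : ball C h -> X h.
Proof. by move=> [_ _]; move/le_lt_trans; apply; exact: ltry. Qed.

(** With [s] and [r] the integrals of [(f - p) * p] and [(f - p) * f], the multiple [C / r] of
    [f - p] pairs with [f] to exactly [C], and its dual norm is at most [s / r]. *)
Lemma separating_functional (E : set T) (f : T -> R) (C : R) :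
  measurable E -> (mu E < +oo)%E -> bsupp E f -> (forall x, 0 <= f x) ->
  0 < C -> (C%:E < nrm f)%E ->
  exists g : T -> R, [/\ measurable_fun setT g, (dnrm mu nrm g <= 1)%E &
    (C%:E <= \int[mu]_x (`|f x * g x|)%:E)%E].
Proof.
move=> mE muE bf f0 C0 Cf.
have [||||||p [Kp pf sepp]] := @solid_separation _ _ _ mu E mE muE (ball C) _ _ _ _ _ _ f bf f0.
- by move=> h [].
- by move=> h [].
- by split => //; rewrite nrm0 lee_fin ltW.
- move=> h k t Kh Kk /andP[t0 t1].
  have [mh h0 hC] := Kh; have [mk k0 kC] := Kk.
  have Xh := ball_inX Kh; have Xk := ball_inX Kk; split.
  + by apply: measurable_funD; apply: measurable_funM.
  + by move=> x; rewrite addr_ge0// mulr_ge0// subr_ge0.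
  apply: le_trans (bfs_triangle BX (inXZ (1 - t) Xh) (inXZ t Xk)) _.
  rewrite !(bfs_scale BX)// !ger0_norm// ?subr_ge0//.
  have -> : C%:E = ((1 - t)%:E * C%:E + t%:E * C%:E)%E.
    by rewrite -!EFinM -EFinD; congr EFin; ring.
  by apply: leeD; apply: lee_wpmul2l => //; rewrite lee_fin// subr_ge0.
- move=> h k Kh mk kh; have [mh h0 hC] := Kh; split => //.
    by move=> x; have /andP[] := kh x.
  apply: le_trans hC; apply: (nrm_mono (ball_inX Kh) mk _).2 => x.
  by have /andP[k0 kh'] := kh x; rewrite !ger0_norm.
- move=> u k Ku und uk.
  have mk : measurable_fun setT k.
    by apply: (@measurable_fun_cvg _ _ _ _ u) => // n; have [] := Ku n.
  have k0 x : 0 <= k x.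
    by apply: (cvgr_to_ge (uk x)); apply: nearW => n; have [_ u0 _] := Ku n.
  have [|||Xk nk] := FX (fun n => ball_inX (Ku n)) mk.
  + by apply: aeW => x n; have [_ u0 _] := Ku n; rewrite u0 und.
  + by apply: aeW => x; exact: uk.
  + by exists C => n; have [] := Ku n.
  split => //; rewrite nk; apply: ge_ereal_sup => _ [n _ <-].
  by have [] := Ku n.
pose g x := f x - p x.
have g0 x : 0 <= g x by rewrite subr_ge0.
have [mp p0 pC] := Kp.
have bp : bsupp E p by apply: (bsupp_le bf mp) => x; rewrite !ger0_norm.
have bg : bsupp E g by exact: bsuppB.
have bI := bsupp_integrable mE muE.
pose s := \int[mu]_x (g x * p x); pose r := \int[mu]_x (g x * f x).
(* The difference [r - s] is the integral of [(f - p) ^+ 2]. If it vanished, [f] would equal [p]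
   almost everywhere and the ideal property would give [nrm f <= C]. *)
have sr : s < r.
  rewrite -subr_gt0 -RintegralB//; [|apply: bI; exact: bsuppM..].
  under eq_Rintegral do rewrite -mulrBr -/(g _).
  rewrite lt_neqAle Rintegral_ge0 ?andbT; last by move=> x _; rewrite mulr_ge0.
  apply/negP => /eqP e0.
  have bgg : bsupp E (fun x => g x * g x) by exact: bsuppM.
  have := bsupp_integralE mE muE bgg; rewrite -e0 => i0.
  have mgg : measurable_fun setT (fun x => (g x * g x)%:E).
    by apply/measurable_EFinP; exact: bgg.1.
  have : (\int[mu]_x `|(g x * g x)%:E| = 0)%E.
    by apply: etrans i0; apply: eq_integral => x _; rewrite gee0_abs// lee_fin mulr_ge0.
  move=> /(ae_eq_integral_abs mu measurableT mgg) gae.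
  have : (nrm f <= nrm p)%E.
    apply: (bfs_ideal BX (ball_inX Kp) bf.1 _).2.
    apply: filterS gae => x /(_ I) /= [] /eqP; rewrite mulf_eq0 orbb /g subr_eq0.
    by move=> /eqP ->.
  by move=> /le_trans /(_ pC); rewrite leNgt Cf.
have s0 : 0 <= s by apply: Rintegral_ge0 => x _; rewrite mulr_ge0.
have r0 : 0 < r by exact: le_lt_trans sr.
have Cr : 0 < C / r by rewrite divr_gt0.
exists (fun x => C / r * g x); split.
- by apply: measurable_funM => //; exact: bg.1.
- apply: dnrm_le => h h1.
  have Xh : X h by rewrite /inX h1 ltry.
  have [Xnh nh] := nrm_norm Xh.
  (* Scaling [|h|] from norm one to norm [C] puts it in the ball, where separation bounds its
     pairing with [f - p] by [s]. *)
  have Kh : ball C (fun x => C * `|h x|).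
    split; first exact: bfs_meas BX _ (inXZ C Xnh).
      by move=> x; rewrite mulr_ge0// ltW.
    by rewrite (bfs_scale BX)// nh h1 mule1 ger0_norm// ltW.
  have mh := bfs_meas BX Xh.
  have := sepp _ Kh; rewrite [X in (_ <= X)%E](bsupp_integralE mE muE); last exact: bsuppM.
  rewrite -/s => le_s.
  have -> : (\int[mu]_x (`|h x * (C / r * g x)|)%:E =
      r^-1%:E * \int[mu]_x ((f x - p x) * (C * `|h x|))%:E)%E.
    rewrite -ge0_integralZl//.
    + apply: eq_integral => x _; rewrite -EFinM normrM.
      rewrite (@ger0_norm _ (C / r * g x)); last by rewrite mulr_ge0// ltW.
      by congr EFin; rewrite /g; ring.
    + apply/measurable_EFinP; apply: measurable_funM; first exact: bg.1.
      by apply: measurable_funM => //; exact: measurableT_comp.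
    + move=> x _; rewrite lee_fin; apply: mulr_ge0; first exact: g0.
      by apply: mulr_ge0 => //; exact: ltW.
    + by rewrite lee_fin invr_ge0 ltW.
  apply: (@le_trans _ _ (r^-1%:E * s%:E)%E).
    by apply: lee_wpmul2l => //; rewrite lee_fin invr_ge0 ltW.
  by rewrite -EFinM lee_fin mulrC ler_pdivrMr// mul1r ltW.
- have -> : (\int[mu]_x (`|f x * (C / r * g x)|)%:E =
      (C / r)%:E * \int[mu]_x (g x * f x)%:E)%E.
    rewrite -ge0_integralZl//.
    + apply: eq_integral => x _; rewrite -EFinM ger0_norm.
        by congr EFin; ring.
      by rewrite mulr_ge0// mulr_ge0// ltW.
    + by apply/measurable_EFinP; apply: measurable_funM; [exact: bg.1|exact: bf.1].
    + by move=> x _; rewrite lee_fin mulr_ge0.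
    + by rewrite lee_fin ltW.
  rewrite (bsupp_integralE mE muE); last exact: bsuppM.
  by rewrite -/r -EFinM divfK// gt_eqF.
Qed.
End banach_function_space.

(** * Integration over countable disjoint unions *)

Section countable_partition.
Context (dT : measure_display) (T : measurableType dT) (R : realType).
Variables (mu : {measure set T -> \bar R}) (P : set (set T)).
Hypotheses (cP : countable P) (mP : forall Q, P Q -> measurable Q).

Let enum_P : exists (N : set nat) (e : nat -> set T), set_bij N P e.
Proof.
have /countable_bijP[N PN] := cP.
by have /card_set_bijP[e eP] := card_esym PN; exists N, e.
Qed.

Lemma countable_bigcup_measurable : measurable (\bigcup_(Q in P) Q).
Proof.
have [N [e [eP _ eS]]] := enum_P.
have -> : \bigcup_(Q in P) Q = \bigcup_(n in N) e n.
  apply/seteqP; split => x [Q].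
    by move=> /eS[n Nn <-] xn; exists n.
  by move=> NQ xQ; exists (e Q) => //; exact: eP.
by apply: bigcup_measurable => n Nn; apply: mP; exact: eP.
Qed.

Lemma integral_bigcup_esum (h : T -> \bar R) : trivIset P id ->
  measurable_fun setT h -> (forall x, (0 <= h x)%E) ->
  (\int[mu]_(x in \bigcup_(Q in P) Q) h x =
   \esum_(Q in P) \int[mu]_(x in Q) h x)%E.
Proof.
move=> tP mh h0; have [N [e eb]] := enum_P; have [eP einj eS] := eb.
(* The enumeration is indexed by a set [N] of naturals, not all of them when [P] is finite; the
   remaining indices receive the empty set. *)
pose F n := if n \in N then e n else set0.
have -> : \bigcup_(Q in P) Q = \bigcup_n F n.
  apply/seteqP; split => x [Q].
    by move=> /eS[n Nn <-] xn; exists n => //; rewrite /F mem_set.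
  move=> _; rewrite /F; case: ifPn => // /set_mem NQ xQ.
  by exists (e Q) => //; exact: eP.
rewrite ge0_integral_bigcup//; last 3 first.
- by move=> n; rewrite /F; case: ifPn => // /set_mem Nn; apply: mP; exact: eP.
- exact: measurable_funTS.
- apply/trivIsetP => i j _ _ ij; rewrite /F.
  case: ifPn => [/set_mem Ni|_]; last by rewrite set0I.
  case: ifPn => [/set_mem Nj|_]; last by rewrite setI0.
  move/trivIsetP : tP; apply; [exact: eP|exact: eP|].
  by apply: contra_neq ij => /einj; apply; exact: mem_set.
rewrite nneseries_esumT; last by move=> n; exact: integral_ge0.
rewrite (reindex_esum _ _ _ _ eb) [RHS]esum_mkcond.
apply: eq_esum => n _; rewrite /F; case: ifPn => // _.
by rewrite integral_set0.
Qed.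

End countable_partition.

(** * Functions constant on each cube of a disjoint collection *)

Section glue.
Variables (R : realType) (d : nat).
Local Notation T := (d.-tuple R).
Variable P : set (set T).
Hypothesis PP : cube_collection P.

Lemma collection_esum_in (c : set T -> \bar R) x Q :
  (forall Q', P Q' -> (0 <= c Q')%E) -> P Q -> Q x ->
  (\esum_(Q' in P) (c Q' * (\1_Q' x)%:E) = c Q)%E.
Proof.
move=> c0 PQ Qx.
have a0 Q' : P Q' -> (0 <= c Q' * (\1_Q' x)%:E)%E.
  by move=> PQ'; rewrite mule_ge0 ?c0// lee_fin.
rewrite (esumID [set Q])// [X in (_ + X)%E]esum1 => [|Q' [PQ' /= QQ']].
  rewrite adde0 (_ : P `&` [set Q] = [set Q]); last first.
    by apply/seteqP; split => [Q' []|_ ->].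
  by rewrite esum_set1 ?a0// indicE mem_set// mule1.
rewrite indicE memNset ?mule0// => Q'x; apply: QQ'.
by apply: PP.2 => //; exists x.
Qed.

Lemma collection_esum_out (c : set T -> \bar R) x :
  ~ (\bigcup_(Q in P) Q) x -> (\esum_(Q' in P) (c Q' * (\1_Q' x)%:E) = 0)%E.
Proof.
move=> nPx; rewrite esum1// => Q PQ; rewrite indicE memNset ?mule0// => Qx.
by apply: nPx; exists Q.
Qed.

(** The preimage of any set is the union of the cubes whose value lies in it, together with the
    complement of the whole union if 0 lies in it. Countability of the collection makes both pieces
    measurable. *)
Lemma measurable_glue (F : T -> R) (c : set T -> R) :
  (forall Q x, P Q -> Q x -> F x = c Q) ->
  (forall x, ~ (\bigcup_(Q in P) Q) x -> F x = 0) -> measurable_fun setT F.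
Proof.
move=> Fin Fout _ Y mY; rewrite setTI.
have mbig (P' : set (set T)) : P' `<=` P -> measurable (\bigcup_(Q in P') Q).
  move=> P'P; apply: countable_bigcup_measurable => [|Q /P'P/PP.1].
    exact: sub_countable (subset_card_le P'P) (cube_collection_countable PP).
  exact: measurable_cube.
have -> : F @^-1` Y = (\bigcup_(Q in [set Q | P Q /\ Y (c Q)]) Q) `|`
    (if 0 \in Y then ~` (\bigcup_(Q in P) Q) else set0).
  apply/seteqP; split => x /=.
    move=> YF; have [[Q PQ Qx]|nP] := pselect ((\bigcup_(Q in P) Q) x).
      by left; exists Q => //=; rewrite -(Fin Q x).
    by right; rewrite mem_set//; move: YF; rewrite Fout.
  move=> [[Q /= [PQ Yc] Qx]|]; first by rewrite (Fin Q).
  by case: ifPn => // /set_mem Y0 nP; rewrite Fout.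
apply: measurableU; first by apply: mbig => Q [].
by case: ifPn => // _; apply: measurableC; exact: mbig.
Qed.

End glue.

(** * The Lorentz-Luxemburg theorem and norms on cubes *)

Section collections.
Variables (R : realType) (d : nat).
Local Notation T := (d.-tuple R).
Variables (mu : {measure set T -> \bar R}) (nrm : (T -> R) -> \bar R).
Hypothesis lebmu : is_lebesgue mu.
Hypothesis BX : is_BFS mu nrm.
Hypothesis FX : fatou_prop mu nrm.
Hypothesis cX : forall Q : set T, is_cube Q -> inX nrm (\1_Q).
Local Notation X := (inX nrm).

Theorem lorentz_luxemburg (F : T -> R) (C : R) : measurable_fun setT F -> 0 <= C ->
  (forall g, measurable_fun setT g -> (dnrm mu nrm g <= 1)%E ->
     (\int[mu]_x (`|F x * g x|)%:E <= C%:E)%E) ->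
  (nrm F <= C%:E)%E.
Proof.
move=> mF C0 FC.
pose E n := @centred_cube R d n.
have mE n : measurable (E n) by apply: measurable_cube; exact: centred_cubeP.
have mnF : measurable_fun setT (fun x => `|F x|) by exact: measurableT_comp.
(* Below a multiple of a cube indicator, [Fn n] lies in [X] by the ideal property and is bounded
   with support of finite measure. *)
pose Fn n x := Num.min `|F x| (n%:R * \1_(E n) x).
have Fn_ge0 n x : 0 <= Fn n x by rewrite le_min normr_ge0 mulr_ge0.
have FnF n x : Fn n x <= `|F x| by rewrite ge_min lexx.
have FnE n x : Fn n x <= n%:R * \1_(E n) x by rewrite ge_min lexx orbT.
have mFn n : measurable_fun setT (Fn n).
  by apply: measurable_minr => //; apply: measurable_funM => //; exact: measurable_indic.
have XFn n : X (Fn n).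
  have XE := inXZ BX n%:R (cX (@centred_cubeP R d n)).
  have [x|//] := nrm_mono BX XE (mFn n).
  by rewrite !ger0_norm ?mulr_ge0//; exact: FnE.
have nFn n : (nrm (Fn n) <= C%:E)%E.
  rewrite leNgt; apply/negP => Cn.
  have nE := nrm_fineK BX (XFn n); set r := fine _ in nE.
  have Cr : C < r by rewrite -lte_fin nE.
  have muE : (mu (E n) < +oo)%E.
    by have [m [_ ->]] := cube_measure lebmu (@centred_cubeP R d n); exact: ltry.
  have bFn : bsupp (E n) (Fn n).
    by split => //; exists n%:R => x; rewrite ger0_norm.
  (* The separating functional only reaches its level weakly and needs a positive level, while [C]
     may be 0. The midpoint between [C] and the norm is positive and gives a strict
     contradiction. *)
  have C'0 : 0 < (C + r) / 2 by lra.
  have C'n : (((C + r) / 2)%:E < nrm (Fn n))%E by rewrite -nE lte_fin; lra.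
  have [g [mg g1 Cg]] := separating_functional BX FX (mE n) muE bFn (Fn_ge0 n) C'0 C'n.
  have := FC g mg g1; apply/negP; rewrite -ltNge.
  apply: (@lt_le_trans _ _ ((C + r) / 2)%:E); first by rewrite lte_fin; lra.
  apply: le_trans Cg _; apply: ge0_le_integral => //.
  - by apply/measurable_EFinP; apply: measurableT_comp => //; exact: measurable_funM.
  - by apply/measurable_EFinP; apply: measurableT_comp => //; exact: measurable_funM.
  - move=> x _; rewrite lee_fin !normrM ler_wpM2r//.
    by rewrite (ger0_norm (Fn_ge0 n x)).
have [|||XF nF] := FX XFn mnF.
- apply: aeW => x n; rewrite Fn_ge0 /= /Fn le_min ge_min lexx /=.
  rewrite ge_min; apply/orP; right.
  apply: ler_pM => //; first by rewrite ler_nat.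
  rewrite !indicE; case: (boolP (x \in E n)) => // /set_mem xn.
  by rewrite mem_set//; exact: centred_cube_nondecreasing xn.
- apply: aeW => x; apply: cvg_near_cst.
  have [m xm] := @centred_cube_cover R d x.
  exists (maxn m (Num.bound `|F x|)) => // n /=; rewrite geq_max => /andP[mn bn].
  apply/min_idPl; rewrite indicE mem_set; last exact: centred_cube_nondecreasing xm.
  rewrite mulr1; apply: le_trans (ltW (archi_boundP (normr_ge0 (F x)))) _.
  by rewrite ler_nat.
- by exists C.
have := nrm_mono BX XF mF => -[x|_ le1]; first by rewrite normr_id.
apply: le_trans le1 _; rewrite nF.
by apply: ge_ereal_sup => _ [n _ <-].
Qed.

Lemma nrm_cube_gt0 (Q : set T) : is_cube Q -> 0 < fine (nrm \1_Q).
Proof.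
move=> Qc; have XQ := cX Qc; have mQ := measurable_cube Qc.
rewrite lt_neqAle fine_ge0 ?andbT; last exact: bfs_ge0 BX _.
apply/negP => /eqP n0.
have : nrm \1_Q = 0%E by rewrite -(nrm_fineK BX XQ) -n0.
move=> /(bfs_eq0 BX (measurable_indic mQ)).
have [m [m0 Qm]] := cube_measure lebmu Qc.
move=> ae0; have : mu Q = 0%E.
  apply: measure_negligible => //; apply: negligibleS ae0 => x Qx /=.
  by rewrite indicE mem_set// => /eqP; rewrite oner_eq0.
by rewrite Qm => -[] mE; move: m0; rewrite mE ltxx.
Qed.

(** A supremum over the empty set would be [-oo], so a function of norm one must be exhibited: the
    normalised indicator of a cube. *)
Lemma dnrm_ge0 (g : T -> R) : (0 <= dnrm mu nrm g)%E.
Proof.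
have Q0 := @centred_cubeP R d 0; set Q := centred_cube _ in Q0.
have r0 := nrm_cube_gt0 Q0; have XQ := cX Q0.
apply: (@le_trans _ _ (\int[mu]_x (`|((fine (nrm \1_Q))^-1 * \1_Q x) * g x|)%:E)%E).
  by apply: integral_ge0 => x _; rewrite lee_fin.
apply: ereal_sup_ubound; exists (fun x => (fine (nrm \1_Q))^-1 * \1_Q x) => //=.
rewrite (bfs_scale BX)// -[X in (_ * X)%E](nrm_fineK BX XQ) -EFinM.
by rewrite ger0_norm ?invr_ge0 ?ltW// mulVf// gt_eqF.
Qed.

Lemma nrmXQ_ge0 (f : T -> R) (Q : set T) : 0 <= nrmXQ nrm f Q.
Proof. by rewrite divr_ge0// fine_ge0//; exact: bfs_ge0 BX _. Qed.

Lemma nrmXQ_fine (f : T -> R) (Q : set T) : is_cube Q ->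
  nrmXQ nrm f Q * fine (nrm \1_Q) = fine (nrm (fun x => f x * \1_Q x)).
Proof. by move=> Qc; rewrite divfK// gt_eqF// nrm_cube_gt0. Qed.

(** This is the exchange behind (a) => (b): on a cube of the collection, [f] and its [S_op] have the
    same norm, so either may replace the other in the products of norms. *)
Lemma nrmXQ_indic (f : T -> R) (Q : set T) : is_cube Q -> X f ->
  nrm (fun x => nrmXQ nrm f Q * \1_Q x) = nrm (fun x => f x * \1_Q x).
Proof.
move=> Qc Xf; have mQ := measurable_cube Qc.
rewrite (bfs_scale BX _ (cX Qc)) (ger0_norm (nrmXQ_ge0 f Q)) -(nrm_fineK BX (cX Qc)).
by rewrite -EFinM nrmXQ_fine// (nrm_fineK BX (inX_indicM BX Xf mQ).1).
Qed.

(** * The operator [S_op] and integration over one collection *)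

Section fixed_collection.
Variable P : set (set T).
Hypothesis PP : cube_collection P.

Let PPm Q : P Q -> measurable Q.
Proof. by move=> /PP.1; exact: measurable_cube. Qed.

Lemma S_op_in (f : T -> R) Q x : P Q -> Q x -> S_op nrm P f x = nrmXQ nrm f Q.
Proof.
move=> PQ Qx; rewrite /S_op; under eq_esum do rewrite EFinM.
by rewrite (collection_esum_in PP (Q := Q))// => Q' _; rewrite lee_fin nrmXQ_ge0.
Qed.

Lemma S_op_out (f : T -> R) x : ~ (\bigcup_(Q in P) Q) x -> S_op nrm P f x = 0.
Proof.
move=> nP; rewrite /S_op; under eq_esum do rewrite EFinM.
by rewrite collection_esum_out.
Qed.

Lemma S_op_ge0 (f : T -> R) x : 0 <= S_op nrm P f x.
Proof.
have [[Q PQ Qx]|nP] := pselect ((\bigcup_(Q in P) Q) x).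
  by rewrite (S_op_in f PQ Qx) nrmXQ_ge0.
by rewrite S_op_out.
Qed.

Lemma measurable_S_op (f : T -> R) : measurable_fun setT (S_op nrm P f).
Proof.
apply: (measurable_glue PP (c := nrmXQ nrm f)); last exact: S_op_out.
exact: S_op_in.
Qed.

Lemma measurable_collection : measurable (\bigcup_(Q in P) Q).
Proof. exact: countable_bigcup_measurable (cube_collection_countable PP) PPm. Qed.

Lemma integral_collection (F g : T -> R) : measurable_fun setT F ->
  measurable_fun setT g -> supported_in mu F P ->
  (\int[mu]_x (`|F x * g x|)%:E = \esum_(Q in P) \int[mu]_(x in Q) (`|F x * g x|)%:E)%E.
Proof.
move=> mF mg sF.
have mFg : measurable_fun setT (fun x => (`|F x * g x|)%:E).
  by apply/measurable_EFinP; apply: measurableT_comp => //; exact: measurable_funM.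
rewrite -(integral_bigcup_esum mu (cube_collection_countable PP) PPm PP.2 mFg)//.
rewrite [RHS]integral_mkcond; apply: ge0_ae_eq_integral => //.
- by apply/(measurable_restrictT _ measurable_collection); exact: measurable_funTS.
- by move=> x _; rewrite patchE; case: ifPn.
move: sF; rewrite /supported_in; apply: filterS => x sFx _.
rewrite patchE; case: ifPn => // /negP nP.
rewrite sFx ?mul0r ?normr0// => Px; apply: nP; exact: mem_set.
Qed.

Lemma holder_cube (f g : T -> R) (Q : set T) : X f -> measurable_fun setT g ->
  measurable Q ->
  (\int[mu]_(x in Q) (`|f x * g x|)%:E <=
   nrm (fun x => f x * \1_Q x)%R * dnrm mu nrm (fun x => g x * \1_Q x)%R)%E.
Proof.
move=> Xf mg mQ.
have mgQ : measurable_fun setT (fun x => g x * \1_Q x).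
  by apply: measurable_funM => //; exact: measurable_indic.
apply: le_trans (holder_dnrm BX (inX_indicM BX Xf mQ).1 mgQ).
rewrite integral_mkcond le_eqVlt; apply/orP; left; apply/eqP.
apply: eq_integral => x _; rewrite patchE indicE.
by case: ifPn => _ /=; rewrite ?mulr1 ?mulr0 ?normr0.
Qed.

End fixed_collection.

(** [S_op] sees [f] only on the union of the cubes, so [f] may be cut down to that union, which does
    not increase its norm. *)
Lemma c_bound_of_upper C : 0 < C -> b_upper mu nrm C -> c_bound nrm C.
Proof.
move=> C0 bC P PP f Xf.
have mU := measurable_collection PP.
set U := \bigcup_(Q in P) Q in mU.
have [XfU le1] := inX_indicM BX Xf mU.
have -> : S_op nrm P f = S_op nrm P (fun x => f x * \1_U x).
  apply/funext => x; rewrite /S_op; congr fine; apply: eq_esum => Q PQ.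
  congr (_ * _)%:E; rewrite /nrmXQ; congr (fine (nrm _) / _).
  apply/funext => y; rewrite -mulrA; congr (_ * _); rewrite !indicE.
  case: (boolP (y \in Q)) => [/set_mem Qy|]; last by rewrite mulr0.
  by rewrite mem_set ?mulr1//; exists Q.
apply: le_trans (bC P PP _ XfU _) _.
  by apply: aeW => x nU; rewrite indicE memNset// mulr0.
by apply: lee_wpmul2l => //; rewrite lee_fin ltW.
Qed.

Lemma upper_of_c_bound C : c_bound nrm C -> b_upper mu nrm C.
Proof. by move=> cC P PP f Xf _; exact: cC. Qed.

Lemma c_bound_inX C P f : c_bound nrm C -> cube_collection P -> X f ->
  X (S_op nrm P f).
Proof.
move=> cC PP Xf; apply: le_lt_trans (cC P PP f Xf) _.
by rewrite -(nrm_fineK BX Xf) -EFinM ltry.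
Qed.

(** * Duality: from (a) to (b) and (c) *)

Let dnrm1_inXd g : measurable_fun setT g -> (dnrm mu nrm g <= 1)%E -> inXd mu nrm g.
Proof. by move=> mg g1; split => //; apply: le_lt_trans g1 _; exact: ltry. Qed.

Let mulr_dnrm1 (C : R) (f g : T -> R) : 0 <= C -> X f -> (dnrm mu nrm g <= 1)%E ->
  (C%:E * nrm f * dnrm mu nrm g <= (C * fine (nrm f))%:E)%E.
Proof.
move=> C0 Xf g1; rewrite EFinM (nrm_fineK BX Xf) -[leRHS]mule1.
apply: lee_wpmul2l => //; apply: mule_ge0; first by rewrite lee_fin.
exact: bfs_ge0 BX f.
Qed.

Lemma c_bound_of_G C : 0 <= C -> G_bound mu nrm C -> c_bound nrm C.
Proof.
move=> C0 GC P PP f Xf.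
rewrite -(nrm_fineK BX Xf) -EFinM.
apply: lorentz_luxemburg; first exact: measurable_S_op.
  by rewrite mulr_ge0// fine_ge0//; exact: bfs_ge0 BX f.
move=> g mg g1.
rewrite (integral_collection PP (measurable_S_op PP f) mg); last first.
  by apply: aeW => x; exact: S_op_out.
apply: le_trans (le_trans (GC P PP f g Xf (dnrm1_inXd mg g1)) (mulr_dnrm1 C0 Xf g1)).
apply: le_esum => Q PQ; have Qc := PP.1 _ PQ; have mQ := measurable_cube Qc.
rewrite -(nrmXQ_indic Qc Xf).
have XQ := inXZ BX (nrmXQ nrm f Q) (cX Qc).
have := holder_cube XQ mg mQ.
have -> : (fun x => nrmXQ nrm f Q * \1_Q x * \1_Q x) = (fun x => nrmXQ nrm f Q * \1_Q x).
  by apply/funext => x; rewrite indicE; case: (x \in Q); rewrite ?mulr1 ?mulr0.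
apply: le_trans; rewrite le_eqVlt; apply/orP; left; apply/eqP.
apply: eq_integral => x /set_mem Qx.
by rewrite (S_op_in PP f PQ Qx) indicE mem_set// mulr1.
Qed.

(** The inequality of [G_bound] is applied to [S_op nrm P f] in place of [f]: the products over the
    cubes do not change, but its norm now stands on the right. *)
Lemma lower_of_G C : 0 < C -> G_bound mu nrm C -> b_lower mu nrm C.
Proof.
move=> C0 GC P PP f Xf sf.
have XS := c_bound_inX (c_bound_of_G (ltW C0) GC) PP Xf.
suff : (nrm f <= (C * fine (nrm (S_op nrm P f)))%:E)%E.
  rewrite EFinM (nrm_fineK BX XS) -[nrm f](nrm_fineK BX Xf) -[nrm (S_op _ _ _)](nrm_fineK BX XS).
  rewrite -!EFinM !lee_fin => le1.
  by rewrite mulrC ler_pdivrMr// mulrC.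
apply: lorentz_luxemburg; first exact: bfs_meas BX _ Xf.
  by apply: mulr_ge0; [exact: ltW|apply: fine_ge0; exact: bfs_ge0 BX _].
move=> g mg g1.
rewrite (integral_collection PP (bfs_meas BX Xf) mg sf).
apply: le_trans (le_trans (GC P PP _ g XS (dnrm1_inXd mg g1)) (mulr_dnrm1 (ltW C0) XS g1)).
apply: le_esum => Q PQ; have Qc := PP.1 _ PQ; have mQ := measurable_cube Qc.
apply: le_trans (holder_cube Xf mg mQ) _.
rewrite -(nrmXQ_indic Qc Xf) (_ : (fun x => S_op nrm P f x * \1_Q x) =
  (fun x => nrmXQ nrm f Q * \1_Q x))//.
apply/funext => x; rewrite indicE.
case: (boolP (x \in Q)) => [/set_mem Qx|]; last by rewrite !mulr0.
by rewrite (S_op_in PP f PQ Qx).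
Qed.

Lemma G_bound_le C C' : C <= C' -> G_bound mu nrm C -> G_bound mu nrm C'.
Proof.
move=> CC' GC P PP f g Xf Xg; apply: le_trans (GC P PP f g Xf Xg) _.
apply: lee_wpmul2r; first exact: dnrm_ge0.
by apply: lee_wpmul2r; [exact: bfs_ge0 BX f|rewrite lee_fin].
Qed.

(** * Testing on a single cube: admissible constants are at least 1 *)

Let cube1 := @centred_cube R d 0.
Let cube1P : is_cube cube1 := @centred_cubeP R d 0.

Let single_collection : cube_collection [set cube1].
Proof.
split; first by move=> Q /= ->; exact: cube1P.
by move=> Q Q' /= -> ->.
Qed.

Let S_op_single : S_op nrm [set cube1] \1_cube1 = \1_cube1.
Proof.
apply/funext => x; have [xQ|nxQ] := pselect (cube1 x).
  rewrite (S_op_in single_collection _ (erefl : [set cube1] cube1) xQ).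
  rewrite /nrmXQ (_ : (fun x => \1_cube1 x * \1_cube1 x) = \1_cube1); last first.
    by apply/funext => y; rewrite indicE; case: (y \in _); rewrite ?mulr1 ?mulr0.
  by rewrite divff ?gt_eqF ?nrm_cube_gt0// indicE mem_set.
by rewrite indicE memNset// S_op_out// => -[Q /= ->].
Qed.

Let supp_single : supported_in mu (\1_cube1) [set cube1].
Proof.
apply: aeW => x nx; rewrite indicE memNset// => xQ.
by apply: nx; exists cube1.
Qed.

Lemma upper_ge1 C : b_upper mu nrm C -> 1 <= C.
Proof.
move=> bC; have XQ := cX cube1P.
have := bC _ single_collection _ XQ supp_single; rewrite S_op_single.
rewrite -(nrm_fineK BX XQ) -EFinM lee_fin -[leLHS]mul1r ler_pM2r//.
exact: nrm_cube_gt0.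
Qed.

Lemma lower_ge1 C : 0 < C -> b_lower mu nrm C -> 1 <= C.
Proof.
move=> C0 bC; have XQ := cX cube1P.
have := bC _ single_collection _ XQ supp_single; rewrite S_op_single.
rewrite -(nrm_fineK BX XQ) -EFinM lee_fin -[leRHS]mul1r ler_pM2r//.
  by rewrite invf_le1.
exact: nrm_cube_gt0.
Qed.

Lemma G_bound_ge1 C : G_bound mu nrm C -> 1 <= C.
Proof.
move=> GC; rewrite leNgt; apply/negP => C1.
(* [G_bound] does not restrict the sign of [C]. The maximum with 1/2 is nonnegative and still below
   1, contradicting [upper_ge1]. *)
have G' : G_bound mu nrm (Num.max C 2^-1) by apply: G_bound_le GC; rewrite le_max lexx.
have m0 : 0 <= Num.max C 2^-1 by rewrite le_max invr_ge0 ler0n orbT.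
have := upper_ge1 (upper_of_c_bound (c_bound_of_G m0 G')).
by rewrite le_max leNgt C1 /= leNgt invf_lt1// ltr1n.
Qed.

(** * From (b) to (a) *)

Lemma G_bound_of_b C2 Ct2 : 0 < C2 -> 0 < Ct2 ->
  b_upper mu nrm C2 -> b_lower mu nrm Ct2 -> G_bound mu nrm (C2 * Ct2).
Proof.
move=> C20 Ct20 bu bl P PP f g Xf [mg Xg].
have cC := c_bound_of_upper C20 bu.
have dg0 := dnrm_ge0 g.
(* The sum is the supremum of its finite partial sums. Over a finite [A] the test function [h] is a
   finite sum, so it lies in [X] without any convergence argument. *)
apply: ge_ereal_sup => _ [A [finA AP] <-].
have PA : cube_collection A.
  by split => [Q /AP /PP.1//|]; exact: sub_trivIset AP PP.2.
pose a Q := fine (nrm (fun x => f x * \1_Q x)).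
pose b Q := fine (dnrm mu nrm (fun x => g x * \1_Q x)).
have mAQ Q : A Q -> measurable Q by move=> /PA.1; exact: measurable_cube.
have aE Q : A Q -> nrm (fun x => f x * \1_Q x) = (a Q)%:E.
  by move=> /mAQ mQ; rewrite /a (nrm_fineK BX (inX_indicM BX Xf mQ).1).
have bE Q : A Q -> dnrm mu nrm (fun x => g x * \1_Q x) = (b Q)%:E.
  move=> /mAQ mQ; rewrite /b fineK// ge0_fin_numE ?dnrm_ge0//.
  exact: le_lt_trans (dnrm_indicM BX mg mQ) Xg.
have a0 Q : 0 <= a Q by apply: fine_ge0; exact: bfs_ge0 BX _.
pose s := fset_set A; pose sa := \sum_(Q <- s) a Q.
have sa0 : 0 <= sa by apply: sumr_ge0.
apply/lee_addgt0Pr => e e0.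
(* The errors [a Q * eta] add up to [sa * eta <= e]; the summand 1 guards against [sa = 0]. *)
pose eta := e / (1 + sa).
have eta0 : 0 < eta by rewrite divr_gt0//; lra.
have ex Q : exists phi : T -> R, X phi /\ (A Q -> nrm phi = 1%E /\
    ((b Q)%:E <= \int[mu]_x (`|phi x * (g x * \1_Q x)|)%:E + eta%:E)%E).
  have [AQ|nAQ] := pselect (A Q); last by exists (fun=> 0); split => //; exact: (inX0 BX).
  have fin : dnrm mu nrm (fun x => g x * \1_Q x) \is a fin_num by rewrite bE.
  have [_ [phi /= phi1 <-] lt1] := ub_ereal_sup_adherent eta0 fin.
  exists phi; split; first by rewrite /inX phi1 ltry.
  by move=> _; split => //; rewrite -bE// -leeBlDr// ltW.
have [phi phiP] := choice ex.
have Xphi Q : X (phi Q) by have [] := phiP Q.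
have phi1 Q : A Q -> nrm (phi Q) = 1%E by move=> AQ; have [_ /(_ AQ)[]] := phiP Q.
have phib Q : A Q -> ((b Q)%:E <= \int[mu]_x (`|phi Q x * (g x * \1_Q x)|)%:E + eta%:E)%E.
  by move=> AQ; have [_ /(_ AQ)[]] := phiP Q.
(* The case distinction puts every term in [X], as [inX_sum] requires, even for sets [Q] that are
   not cubes. *)
pose t Q x := if Q \in A then a Q * (`|phi Q x| * \1_Q x) else 0.
have Xt Q : X (t Q).
  rewrite /t; case: (boolP (Q \in A)) => [/set_mem AQ|_]; last exact: (inX0 BX).
  exact: (inXZ BX _ (inX_indicM BX (nrm_norm BX (Xphi Q)).1 (mAQ _ AQ)).1).
pose h x := \sum_(Q <- s) t Q x.
have Xh : X h by exact: (inX_sum BX).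
have mh := bfs_meas BX Xh.
have h_in Q x : A Q -> Q x -> h x = a Q * `|phi Q x|.
  move=> AQ Qx; have Qs : Q \in s by rewrite in_fset_set ?mem_set.
  rewrite /h (bigD1_seq Q Qs (finmap.fset_uniq _))/= big1_seq.
    by rewrite addr0 /t mem_set// indicE mem_set// mulr1.
  move=> Q' /andP[QQ' Q's]; rewrite /t; case: ifPn => // /set_mem AQ'.
  rewrite indicE memNset ?mulr0// => Q'x; move/eqP : QQ'; apply.
  by apply: PA.2 => //; exists x.
have h_out x : ~ (\bigcup_(Q in A) Q) x -> h x = 0.
  move=> nA; rewrite /h big1_seq// => Q _; rewrite /t; case: ifPn => // /set_mem AQ.
  by rewrite indicE memNset ?mulr0// => Qx; apply: nA; exists Q.
have sh : supported_in mu h A by exact: aeW.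
(* As [phi Q] has norm one, the norm of [h] on [Q] is at most [a Q], so
   [S_op nrm A h <= S_op nrm A f]. The lower bound for [h] is chained with the upper bound for [f],
   in the form [c_bound] since [f] need not be supported in [A]. *)
have nh : (nrm h <= (C2 * Ct2)%:E * nrm f)%E.
  have XSf := c_bound_inX cC PA Xf.
  have [|XSh SS] := nrm_mono BX XSf (measurable_S_op PA h).
    move=> x; rewrite !ger0_norm ?S_op_ge0//.
    have [[Q AQ Qx]|nA] := pselect ((\bigcup_(Q in A) Q) x); last by rewrite !S_op_out.
    rewrite !(S_op_in PA _ AQ Qx) ler_pM2r ?invr_gt0 ?nrm_cube_gt0//; last exact: PA.1.
    have mQ := mAQ _ AQ.
    have [Xn nn] := nrm_norm BX (Xphi Q).
    have [Xi ni] := inX_indicM BX Xn mQ.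
    have -> : (fun y => h y * \1_Q y) = (fun y => a Q * (`|phi Q y| * \1_Q y)).
      apply/funext => y; rewrite indicE; case: (boolP (y \in Q)) => [/set_mem Qy|_].
        by rewrite (h_in Q)// !mulr1.
      by rewrite !mulr0.
    rewrite (bfs_scale BX)// ger0_norm// -lee_fin fineK; last first.
      by rewrite fin_numM// (inX_fin BX).
    rewrite (nrm_fineK BX (inX_indicM BX Xf mQ).1) aE// -[leRHS]mule1.
    apply: lee_wpmul2l; first by rewrite lee_fin.
    by rewrite -(phi1 _ AQ) -nn.
  have := bl A PA h Xh sh.
  have := le_trans SS (cC A PA f Xf).
  rewrite -(nrm_fineK BX Xh) -(nrm_fineK BX XSh) -(nrm_fineK BX Xf) -!EFinM !lee_fin.
  move=> le1 le2; have : fine (nrm h) <= Ct2 * fine (nrm (S_op nrm A h)).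
    by rewrite mulrC -ler_pdivrMr// mulrC.
  move/le_trans; apply; rewrite (mulrC C2) -mulrA.
  by rewrite ler_pM2l.
apply: (@le_trans _ _ (\int[mu]_x (`|h x * g x|)%:E + e%:E)%E); last first.
  rewrite leeD2r//; apply: le_trans (holder_dnrm BX Xh mg) _.
  exact: lee_wpmul2r.
rewrite (integral_collection PA mh mg sh) -esum_fset//; last first.
  by move=> Q _; rewrite mule_ge0 ?dnrm_ge0//; exact: bfs_ge0 BX _.
apply: (@le_trans _ _ (\esum_(Q in A) (\int[mu]_(x in Q) (`|h x * g x|)%:E + (a Q * eta)%:E))%E).
  apply: le_esum => Q AQ; rewrite aE// bE//.
  have -> : (\int[mu]_(x in Q) (`|h x * g x|)%:E =
      (a Q)%:E * \int[mu]_x (`|phi Q x * (g x * \1_Q x)|)%:E)%E.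
    have mphi := bfs_meas BX (Xphi Q).
    have mQ := mAQ _ AQ.
    rewrite -ge0_integralZl//.
    - rewrite [LHS]integral_mkcond; apply: eq_integral => x _.
      rewrite patchE indicE; case: ifPn => [/set_mem Qx|_].
        by rewrite (h_in Q)// mulr1 -EFinM !normrM normr_id (ger0_norm (a0 Q)) mulrA.
      by rewrite !mulr0 normr0 mule0.
    - apply/measurable_EFinP; apply: measurableT_comp => //.
      by apply: measurable_funM => //; apply: measurable_funM => //; exact: measurable_indic.
    - by rewrite lee_fin.
  rewrite EFinM -ge0_muleDr ?lee_fin ?(ltW eta0)//; last first.
    by apply: integral_ge0 => x _; rewrite lee_fin.
  by rewrite EFinM; apply: lee_wpmul2l; [rewrite lee_fin|exact: phib].
rewrite esumD; last 2 first.
- by move=> Q _; apply: integral_ge0 => x _; rewrite lee_fin.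
- by move=> Q _; rewrite lee_fin mulr_ge0// ltW.
rewrite leeD2l// esum_fset//; last by move=> Q _; rewrite lee_fin mulr_ge0// ltW.
rewrite fsbig_finite//= sumEFin lee_fin -mulr_suml -/s -/sa /eta mulrA.
rewrite ler_pdivrMr; nra.
Qed.

(** * Averages over cubes and the passage from (c) to [A_strong] *)

Lemma avg1_ge0 (f : T -> R) Q : (0 <= avg1 mu f Q)%E.
Proof.
apply: mule_ge0; first by rewrite lee_fin invr_ge0 fine_ge0.
by apply: integral_ge0 => x _; rewrite lee_fin.
Qed.

Lemma A_op_in P (f : T -> R) Q x : cube_collection P -> P Q -> Q x ->
  A_op mu P f x = fine (avg1 mu f Q).
Proof.
move=> PP PQ Qx; rewrite /A_op (collection_esum_in PP (Q := Q))// => Q' _.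
exact: avg1_ge0.
Qed.

Lemma A_op_out P (f : T -> R) x : ~ (\bigcup_(Q in P) Q) x -> A_op mu P f x = 0.
Proof. by move=> nP; rewrite /A_op collection_esum_out. Qed.

Lemma measurable_A_op P (f : T -> R) : cube_collection P ->
  measurable_fun setT (A_op mu P f).
Proof.
move=> PP; apply: (measurable_glue PP (c := fun Q => fine (avg1 mu f Q))).
  by move=> Q x; exact: A_op_in.
exact: A_op_out.
Qed.

(** Hoelder's inequality on [Q] for [f] against the constant 1; multiplying and dividing by the norm
    of the indicator brings out [A_quantity]. *)
Lemma avg1_le (f : T -> R) (Q : set T) : is_cube Q -> X f ->
  (avg1 mu f Q <= (nrmXQ nrm f Q)%:E * A_quantity mu nrm Q)%E.
Proof.
move=> Qc Xf; have mQ := measurable_cube Qc.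
have [m [m0 Qm]] := cube_measure lebmu Qc.
have := @holder_cube f (fun=> 1) Q Xf (measurable_cst _) mQ.
rewrite /avg1 /A_quantity Qm /=.
under eq_integral do rewrite mulr1.
rewrite (_ : (fun x => 1 * \1_Q x) = \1_Q); last by apply/funext => x; rewrite mul1r.
move=> le1.
rewrite -[X in (_ <= _ * X)%E]muleA [leRHS]muleCA.
apply: lee_wpmul2l; first by rewrite lee_fin invr_ge0 ltW.
rewrite muleA -(nrm_fineK BX (cX Qc)) -EFinM nrmXQ_fine//.
by rewrite (nrm_fineK BX (inX_indicM BX Xf mQ).1).
Qed.

(** Hoelder's inequality for a cube indicator against itself. The positivity is needed to scale an
    infimum by this constant. *)
Lemma A_const_ge1 : (1 <= A_const mu nrm)%E.
Proof.
apply: (@le_trans _ _ (A_quantity mu nrm cube1)); last first.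
  by apply: ereal_sup_ubound; exists cube1.
have mQ := measurable_cube cube1P.
have := holder_dnrm BX (cX cube1P) (measurable_indic mQ : measurable_fun setT (\1_cube1 : T -> R)).
under eq_integral => x _.
  rewrite (_ : `|_| = \1_cube1 x); last first.
    by rewrite indicE; case: (x \in _); rewrite ?mulr1 ?mulr0 ?normr1 ?normr0.
  over.
rewrite integral_indic// setIT /A_quantity.
have [m [m0 ->]] := cube_measure lebmu cube1P => /= le1.
rewrite -muleA -[leLHS]/(1%:E) -(mulVf (lt0r_neq0 m0)) EFinM.
by apply: lee_wpmul2l => //; rewrite lee_fin invr_ge0 ltW.
Qed.

Lemma Astrong_of_c C A : (A_const mu nrm = A%:E)%E -> c_bound nrm C ->
  Astrong_bound mu nrm (C * A).
Proof.
move=> AE cC P PP f Xf.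
have A1 : 1 <= A by rewrite -lee_fin -AE; exact: A_const_ge1.
have XS := c_bound_inX cC PP Xf.
have [x|_] := nrm_mono BX (inXZ BX A XS) (@measurable_A_op P f PP).
  have [[Q PQ Qx]|nP] := pselect ((\bigcup_(Q in P) Q) x); last first.
    by rewrite A_op_out// normr0.
  rewrite (A_op_in f PP PQ Qx) (S_op_in PP f PQ Qx) !ger0_norm; last 2 first.
  - by rewrite mulr_ge0 ?nrmXQ_ge0//; lra.
  - by apply: fine_ge0; exact: avg1_ge0.
  (* [A_op] is defined through [fine], which sends [+oo] to 0. The bound is first proved in the
     extended reals, where it also shows that the average is finite. *)
  have le1 : (avg1 mu f Q <= (A * nrmXQ nrm f Q)%:E)%E.
    apply: le_trans (avg1_le (PP.1 _ PQ) Xf) _; rewrite (mulrC A) [leRHS]EFinM.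
    apply: lee_wpmul2l; first by rewrite lee_fin nrmXQ_ge0.
    by rewrite -AE; apply: ereal_sup_ubound; exists Q => //; exact: PP.1.
  rewrite -lee_fin fineK// ge0_fin_numE ?avg1_ge0//.
  by apply: le_lt_trans le1 _; exact: ltry.
move=> le1; apply: le_trans le1 _.
rewrite (bfs_scale BX)// ger0_norm; last by lra.
rewrite (mulrC C) EFinM -muleA; apply: lee_wpmul2l; first by rewrite lee_fin; lra.
exact: cC.
Qed.

End collections.

(** * Optimal constants and the final assembly *)

Lemma le_ereal_inf_mulr (R : realType) (x : \bar R) (S : set R) (r : R) : 0 < r ->
  (forall C, S C -> (x <= (C * r)%:E)%E) ->
  (x <= ereal_inf [set C%:E | C in S] * r%:E)%E.
Proof.
(* Multiplication by a positive real commutes with the infimum, even for empty [S]. *)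
move=> r0 H; rewrite muleC -ereal_inf_pZl//; apply: le_ereal_inf_tmp => _ [_ [C SC <-] <-].
by rewrite -EFinM mulrC; exact: H.
Qed.

Theorem theorem3p9 (R : realType) (d : nat)
  (mu : {measure set (d.-tuple R) -> \bar R})
  (nrm : (d.-tuple R -> R) -> \bar R) :
  is_lebesgue mu ->
  is_BFS mu nrm ->
  fatou_prop mu nrm ->
  (forall Q, is_cube Q -> inX nrm (\1_Q)) ->
  [/\ (in_G mu nrm <-> cond_b mu nrm),
      (cond_b mu nrm -> cond_c nrm),
      (in_G mu nrm ->
         C2_opt mu nrm = C3_opt nrm /\
         (maxe (C2_opt mu nrm) (Ct2_opt mu nrm) <= G_const mu nrm <=
            C2_opt mu nrm * Ct2_opt mu nrm)%E) &
      (in_A mu nrm -> cond_c nrm ->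
         in_Astrong mu nrm /\
         (Astrong_const mu nrm <= C3_opt nrm * A_const mu nrm)%E)].
Proof.
move=> lebmu BX FX cX.
have G_upper C : G_bound mu nrm C -> 0 < C /\ b_upper mu nrm C.
  move=> GC; have C1 := G_bound_ge1 lebmu BX FX cX GC.
  have C0 : 0 < C by lra.
  by split => //; apply: upper_of_c_bound; exact: c_bound_of_G (ltW C0) GC.
have G_lower C : G_bound mu nrm C -> 0 < C /\ b_lower mu nrm C.
  move=> GC; have [C0 _] := G_upper C GC.
  by split => //; exact: lower_of_G GC.
(* The two sets of admissible constants coincide, so neither infimum has to be attained. *)
have opt_eq : C2_opt mu nrm = C3_opt nrm.
  congr (ereal_inf (EFin @` _)); apply/seteqP; split => C [C0 bC]; split => //.
    exact: c_bound_of_upper bC.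
  exact: upper_of_c_bound.
split.
- split=> [[C GC]|[C2 [Ct2 [C20 Ct20 bu bl]]]].
    have [C0 bu] := G_upper C GC; have [_ bl] := G_lower C GC.
    by exists C, C.
  by exists (C2 * Ct2); exact: G_bound_of_b bu bl.
- move=> [C2 [_ [C20 _ bu _]]]; exists C2; split => //.
  exact: c_bound_of_upper bu.
- move=> [C GC]; split => //; apply/andP; split.
    rewrite ge_max; apply/andP; split; apply: le_ereal_inf_tmp => _ [C' GC' <-];
      apply: ereal_inf_lbound; exists C' => //; [exact: G_upper|exact: G_lower].
  (* The product of infima is handled one factor at a time, and the factor held fixed must be a
     positive real. Here [Ct2_opt] is at least 1 and is bounded by the constant [C] of [G_bound]. *)
  have [i [i0 iE]] : exists i : R, 0 < i /\ Ct2_opt mu nrm = i%:E.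
    have ge1 : (1 <= Ct2_opt mu nrm)%E.
      apply: le_ereal_inf_tmp => _ [C' [C'0 bC'] <-].
      by rewrite lee_fin; exact: lower_ge1 bC'.
    have leC : (Ct2_opt mu nrm <= C%:E)%E.
      by apply: ereal_inf_lbound; exists C => //; exact: G_lower.
    have fin : Ct2_opt mu nrm \is a fin_num.
      rewrite ge0_fin_numE; first by apply: le_lt_trans leC _; exact: ltry.
      by apply: le_trans ge1.
    exists (fine (Ct2_opt mu nrm)); rewrite fineK//; split => //.
    by rewrite -lte_fin fineK//; apply: lt_le_trans ge1; rewrite lte_fin.
  rewrite iE; apply: le_ereal_inf_mulr => // C2 [C20 bu].
  rewrite mulrC EFinM -iE; apply: le_ereal_inf_mulr => // Ct2 [Ct20 bl].
  apply: ereal_inf_lbound; exists (Ct2 * C2) => //; rewrite mulrC.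
  exact: G_bound_of_b bu bl.
- move=> [_ Afin] [C3 [C30 cC3]].
  have A1 := A_const_ge1 lebmu BX cX.
  have AE : A_const mu nrm = (fine (A_const mu nrm))%:E.
    by rewrite fineK// ge0_fin_numE//; apply: le_trans A1.
  split; first by exists (C3 * fine (A_const mu nrm)); exact: Astrong_of_c AE cC3.
  rewrite AE; apply: le_ereal_inf_mulr => [|C [C0 cC]].
    by rewrite -lte_fin -AE; apply: lt_le_trans A1; rewrite lte_fin.
  apply: ereal_inf_lbound; exists (C * fine (A_const mu nrm)) => //.
  exact: Astrong_of_c AE cC.
Qed.
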